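(* For each $h>0$ there exists a one-parameter family of helicoidal surfaces with pitch $h$ that rotate with unit speed around their helicoidal axis under the mean curvature flow. Each of the corresponding generating curves $X:\mathbf R\to\mathbf R^2$ has the following properties: it has exactly one point closest to the origin and consists of two properly embedded arms coming from this point along each of which the distance to the origin strictly increases to infinity; each arm has infinite total curvature and spirals infinitely many times around the origin; the curvature goes to $0$ along each arm, and the limiting angle between the tangent and the location (position vector) along each arm is $\frac{\pi}{2}$.
   Context: Identify $\mathbf R^2$ with $\mathbf C$. For $h>0$ and an immersed curve $X:\mathbf R\to\mathbf R^2$ parametrized by arc length $s$, the helicoidal surface of pitch $h$ (with helicoidal axis the $z$-axis) generated by $X$ is the immersed surface $F(s,t)=(e^{it}X(s),ht)$, $s,t\in\mathbf R$, in $\mathbf R^3$. Put $T=\frac{dX}{ds}$, $N=iT$, signed curvature $k=\langle\frac{d^2X}{ds^2},N\rangle$, $\tau=\langle X,T\rangle$, $\nu=\langle X,N\rangle$, $r=|X|$. The unit normal is $\mathbf n=\frac{(he^{it}N,-\tau)}{\sqrt{\tau^2+h^2}}$ and $H=\operatorname{div}\mathbf n$; the mean curvature vector is $-H\mathbf n$. The surface rotates with unit speed around the $z$-axis under the mean curvature flow (up to tangential diffeomorphisms) if and only if $-H=\langle RF,\mathbf n\rangle$, where $R(x,y,z)=(-y,x,0)$; in terms of $X$ this is the equation $$k=\tau\frac{\tau^2+h^2}{r^2+h^2}-\frac{\nu}{r^2+h^2},$$ under which $(\tau,\nu)$ solves the planar autonomous system $\tau'=\frac{\tau^2+h^2}{r^2+h^2}(1+\tau\nu)$,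 $\nu'=\frac{\tau\nu-\tau^2(\tau^2+h^2)}{r^2+h^2}$, with $r^2=\tau^2+\nu^2$. The family consists of the surfaces generated by the curves $X:\mathbf R\to\mathbf R^2$ satisfying this equation; ''one-parameter'' refers to the one-parameter space of trajectories of the $(\tau,\nu)$ system, each trajectory determining the curve up to rotation about the origin and shift of the arc length parameter. Total curvature of an arm is $\int k\,ds$ over the arm (as an improper integral), and ''infinite'' means it diverges to $+\infty$ or $-\infty$. ''Spirals infinitely many times around the origin'' means that a continuous choice of the angle $\phi$ with $X=re^{i\phi}$ is unbounded along the arm (tends to infinity in absolute value). *)

(* Defs.v *)
From Stdlib Require Import Reals.
From Coquelicot Require Import Coquelicot.
Open Scope R_scope.

(** The plane is identified with [C], and space with [C * R], the second
    component being the height along the z-axis. *)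
Definition R3 : Type := (C * R)%type.

Definition expi (a : R) : C := (cos a, sin a).

Definition dot2 (z w : C) : R := Re z * Re w + Im z * Im w.
Definition dot3 (u v : R3) : R := dot2 (fst u) (fst v) + snd u * snd v.

Definition scal3 (a : R) (u : R3) : R3 :=
  ((a * Re (fst u), a * Im (fst u)), a * snd u).

Definition cross3 (u v : R3) : R3 :=
  let '((u1, u2), u3) := u in
  let '((v1, v2), v3) := v in
  ((u2 * v3 - u3 * v2, u3 * v1 - u1 * v3), u1 * v2 - u2 * v1).

Definition norm3 (u : R3) : R := sqrt (dot3 u u).

Definition D2 (X : R -> C) (s : R) : C :=
  (Derive (fun u => Re (X u)) s, Derive (fun u => Im (X u)) s).

Definition D3 (f : R -> R3) (s : R) : R3 :=
  (D2 (fun u => fst (f u)) s, Derive (fun u => snd (f u)) s).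

(** * Plane curves *)

Definition smooth_curve (X : R -> C) : Prop :=
  forall (n : nat) (s : R),
    ex_derive_n (fun u => Re (X u)) n s /\ ex_derive_n (fun u => Im (X u)) n s.

Definition arclength_curve (X : R -> C) : Prop :=
  smooth_curve X /\ forall s, Cmod (D2 X s) = 1.

Definition tangent (X : R -> C) (s : R) : C := D2 X s.
Definition normal (X : R -> C) (s : R) : C := (Ci * tangent X s)%C.
Definition curvature (X : R -> C) (s : R) : R := dot2 (D2 (D2 X) s) (normal X s).
Definition tau (X : R -> C) (s : R) : R := dot2 (X s) (tangent X s).
Definition nu (X : R -> C) (s : R) : R := dot2 (X s) (normal X s).

(** Unoriented angle, in [[0, PI]], between two nonzero vectors. *)
Definition angle (z w : C) : R := acos (dot2 z w / (Cmod z * Cmod w)).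

(** * Parametrized surfaces and mean curvature flow *)

Definition surf_s (S : R -> R -> R3) (s t : R) : R3 := D3 (fun u => S u t) s.
Definition surf_t (S : R -> R -> R3) (s t : R) : R3 := D3 (fun u => S s u) t.

(** With this orientation, the unit normal of the helicoidal surface below is
    [(h e^{it} N, - tau) / sqrt (tau^2 + h^2)]. *)
Definition unit_normal (S : R -> R -> R3) (s t : R) : R3 :=
  let m := cross3 (surf_t S s t) (surf_s S s t) in scal3 (/ norm3 m) m.

(** Divergence along the surface [S] of a vector field [V] given in the
    parameters of [S]: the trace [g^{ij} <d_i V, d_j S>]. *)
Definition surf_div (S V : R -> R -> R3) (s t : R) : R :=
  let Ss := surf_s S s t in
  let St := surf_t S s t in
  let Vs := surf_s V s t in
  let Vt := surf_t V s t in
  let g11 := dot3 Ss Ss in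
  let g12 := dot3 Ss St in
  let g22 := dot3 St St in
  (g22 * dot3 Vs Ss - g12 * (dot3 Vs St + dot3 Vt Ss) + g11 * dot3 Vt St)
  / (g11 * g22 - g12 ^ 2).

Definition mean_curvature (S : R -> R -> R3) (s t : R) : R :=
  surf_div S (unit_normal S) s t.

Definition mean_curvature_vector (S : R -> R -> R3) (s t : R) : R3 :=
  scal3 (- mean_curvature S s t) (unit_normal S s t).

(** Mean curvature flow up to tangential diffeomorphisms: only the normal
    component of the velocity of the family is prescribed. *)
Definition moves_by_mcf (G : R -> R -> R -> R3) : Prop :=
  forall theta s t : R,
    let n := unit_normal (G theta) s t in
    scal3 (dot3 (D3 (fun u => G u s t) theta) n) n
    = mean_curvature_vector (G theta) s t.

Definition rotz (theta : R) (u : R3) : R3 := ((expi theta * fst u)%C, snd u).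

Definition rotates_with_unit_speed_under_mcf (S : R -> R -> R3) : Prop :=
  moves_by_mcf (fun theta s t => rotz theta (S s t)).

Definition helicoidal_surface (h : R) (X : R -> C) (s t : R) : R3 :=
  ((expi t * X s)%C, h * t).

Definition generates_rotator (h : R) (X : R -> C) : Prop :=
  arclength_curve X /\
  rotates_with_unit_speed_under_mcf (helicoidal_surface h X).

(** * The family of generating curves *)

Definition solves_tau_nu_system (h : R) (a b : R -> R) : Prop :=
  forall s : R,
    let r2 := a s ^ 2 + b s ^ 2 in
    is_derive a s ((a s ^ 2 + h ^ 2) / (r2 + h ^ 2) * (1 + a s * b s)) /\
    is_derive b s ((a s * b s - a s ^ 2 * (a s ^ 2 + h ^ 2)) / (r2 + h ^ 2)).

(** The trajectory of [(tau, nu)], as a subset of the phase plane. *)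
Definition trajectory (X : R -> C) (q : R * R) : Prop :=
  exists s : R, q = (tau X s, nu X s).

Definition equal_up_to_rotation_and_shift (X Y : R -> C) : Prop :=
  exists alpha c : R, forall s : R, Y s = (expi alpha * X (s + c)%R)%C.

(** The curves [X p] represent all the generating curves, and [p] is a
    coordinate on the space of trajectories: these fill the whole phase plane,
    and the point [(tau, nu)] depends continuously on [p] and [s]. *)
Definition one_parameter_family (h : R) (X : R -> R -> C) : Prop :=
  (forall p : R, generates_rotator h (X p)) /\
  (forall q : R * R,
     continuous (fun q : R * R => X (fst q) (snd q)) q /\
     continuous (fun q : R * R => tangent (X (fst q)) (snd q)) q) /\
  (forall Y : R -> C, generates_rotator h Y ->
     exists! p : R, equal_up_to_rotation_and_shift (X p) Y) /\
  (forall p : R, solves_tau_nu_system h (tau (X p)) (nu (X p))) /\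
  (forall q : R * R, exists! p : R, trajectory (X p) q) /\
  (forall Y Z : R -> C, generates_rotator h Y -> generates_rotator h Z ->
     (forall q : R * R, trajectory Y q <-> trajectory Z q) ->
     equal_up_to_rotation_and_shift Y Z).

(** * Arms *)

Definition closest_to_origin (X : R -> C) (s0 : R) : Prop :=
  forall s : R, Cmod (X s0) <= Cmod (X s).

(** The two arms issued from [X s0] are [fun u => arm X s0 e u], [0 <= u], for
    [e = 1] and [e = - 1]. *)
Definition arm (X : R -> C) (s0 e u : R) : C := X (s0 + e * u).

(** [Y] restricted to [[0, +oo)] is injective and proper (preimages of bounded
    sets are bounded); for a regular curve this is a proper embedding. *)
Definition properly_embedded (Y : R -> C) : Prop :=
  (forall u v : R, 0 <= u -> 0 <= v -> Y u = Y v -> u = v) /\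
  (forall M : R, exists U : R, forall u : R, 0 <= u -> Cmod (Y u) <= M -> u <= U).

Definition strictly_increases_to_infinity (f : R -> R) : Prop :=
  (forall u v : R, 0 <= u -> u < v -> f u < f v) /\ is_lim f p_infty p_infty.

Definition infinite_total_curvature (X : R -> C) (s0 e : R) : Prop :=
  let K := fun U => RInt (fun u => curvature X (s0 + e * u)) 0 U in
  is_lim K p_infty p_infty \/ is_lim K p_infty m_infty.

(** The endpoint [u = 0] is left out since it may be the origin, where the
    angle is undefined. *)
Definition spirals_infinitely (Y : R -> C) : Prop :=
  exists phi : R -> R,
    (forall u : R, 0 < u ->
       continuous phi u /\ Y u = (RtoC (Cmod (Y u)) * expi (phi u))%C) /\
    is_lim (fun u => Rabs (phi u)) p_infty p_infty.

Definition arm_properties (X : R -> C) (s0 e : R) : Prop :=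
  properly_embedded (arm X s0 e) /\
  strictly_increases_to_infinity (fun u => Cmod (arm X s0 e u)) /\
  infinite_total_curvature X s0 e /\
  spirals_infinitely (arm X s0 e) /\
  is_lim (fun u => curvature X (s0 + e * u)) p_infty 0 /\
  is_lim (fun u => angle (tangent X (s0 + e * u)) (X (s0 + e * u)))
    p_infty (PI / 2).

(* Main.v *)
Require Import Defs.
From Stdlib Require Import Reals Lra Lia.
From Stdlib Require Import FunctionalExtensionality Classical IndefiniteDescription.
From Coquelicot Require Import Coquelicot.
Open Scope R_scope.

(** Write [t] and [n] for the functions tau and nu of a unit speed curve, so
    that the curve is [(t + i n) T], and [D] for [t^2 + n^2 + h^2].  The
    normal velocity of the rotating helicoidal surface and its mean curvature
    are both functions of [t], [n] and the curvature [k] divided by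
    [sqrt (t^2 + h^2)], and their equality is [k = bend h t n]
    ([rotator_condition]).  The generating curves are therefore the solutions
    of an ordinary differential equation for [(X, T)].

    The asymptotics rest on one monotone quantity: along a solution,
    [n - atan (t / h) / h] has derivative
    [- (1 + t^2 (t^2 + h^2)) / D] ([potential_derive]).  If it were bounded
    below, [n] would be bounded, the derivative would stay away from 0, and
    the quantity would diverge after all; so [n] tends to minus infinity
    ([nu_tends_to_minus_infinity]).  The system is invariant under
    [(t, n, s) -> (- t, - n, - s)], hence [n] tends to plus infinity at the
    other end, and only one arm has to be studied.  Since [(t^2 + n^2)' = 2 t],
    the distance to the origin could not grow without [t] becoming positive;
    with the symmetry, [t] has a zero, which is unique because [t' > 0] there.
    This zero is the point closest to the origin, and the distance is strictly
    monotone on both sides of it.  On the arm starting there, [t > 0], and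
    [t' < 0] as soon as [t > 1] and [n <= -1], so [t] is bounded by some [K]
    ([tau_bounded_on_arm]).  Now everything follows: [k] and [t / |X|] are
    bounded by constants over [|n|] and tend to 0; [k >= 1 / D] eventually,
    while [(ln D)' = 2 t / D <= 2 K / D], so the integral of [k] diverges like
    [ln D] at least ([total_bending_diverges]); and the polar angle of [X] is
    the turning angle of [T] plus [atan (n / t)], which is bounded
    ([profile_spirals]).

    Existence is a Picard iteration for the tangent angle alone, the position
    being an integral of it.  Its iterates all satisfy [|X s| <= |X 0| + |s|],
    and in such a region the equation is Lipschitz: this gives global
    solutions although the vector field grows too fast to be globally Lipschitz
    ([profile_exists]).  A Gronwall estimate gives uniqueness and
    continuous dependence ([profile_stability]).  Because [(t, n)] determines
    the frame up to a rotation, two curves whose trajectories meet agree up to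
    rotation and shift ([profile_rigidity]); and because [t] vanishes exactly
    once on each curve, the value of [n] there is a coordinate on the space of
    trajectories: the family consists of the solutions with [X 0 = i p] and
    [T 0 = 1]. *)

(** * Curves with a moving frame *)

Definition along (X T : R -> C) (s : R) : R := dot2 (X s) (T s).
Definition across (X T : R -> C) (s : R) : R := dot2 (X s) (Ci * T s)%C.

(** The curvature prescribed by the rotator equation at a point with
    coordinates [t] and [n] in the moving frame. *)
Definition bend (h t n : R) : R :=
  (t * (t ^ 2 + h ^ 2) - n) / (t ^ 2 + n ^ 2 + h ^ 2).

(** The tangent and the curvature are data, tied to [X] by derivatives of the
    coordinates; rotating, shifting or reversing the curve then amounts to
    transforming these data. *)
Record framed_curve (X T : R -> C) (k : R -> R) : Prop := {
  fc_ReX : forall s, is_derive (fun u => Re (X u)) s (Re (T s));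
  fc_ImX : forall s, is_derive (fun u => Im (X u)) s (Im (T s));
  fc_ReT : forall s, is_derive (fun u => Re (T u)) s (- k s * Im (T s));
  fc_ImT : forall s, is_derive (fun u => Im (T u)) s (k s * Re (T s));
  fc_unit : forall s, Re (T s) ^ 2 + Im (T s) ^ 2 = 1 }.

(** The rotator equation with only the regularity it needs in order to be
    stated.  It is equivalent to [generates_rotator], by [profile_generates] and
    [generator_profile]. *)
Definition profile_solution (h : R) (X T : R -> C) : Prop :=
  framed_curve X T (fun s => bend h (along X T s) (across X T s)).

(** Derivative lemmas leave equations in the carrier of a normed module, where
    [ring] does not recognize the reals. *)
Ltac real_ring :=
  match goal with |- @eq _ ?a ?b => change (@eq R a b) end; ring.

Lemma is_derive_eq : forall (f : R -> R) (s l l' : R),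
  is_derive f s l -> l = l' -> is_derive f s l'.
Proof. intros f s l l' H E; rewrite <- E; exact H. Qed.

Lemma is_derive_product : forall (f g : R -> R) s f' g',
  is_derive f s f' -> is_derive g s g' ->
  is_derive (fun u => f u * g u) s (f' * g s + f s * g').
Proof.
  intros f g s f' g' Hf Hg.
  apply (is_derive_mult (K := R_AbsRing)); [exact Hf | exact Hg | exact Rmult_comm].
Qed.

Lemma is_derive_lincomb : forall c d (f g : R -> R) s f' g',
  is_derive f s f' -> is_derive g s g' ->
  is_derive (fun u => c * f u + d * g u) s (c * f' + d * g').
Proof.
  intros c d f g s f' g' Hf Hg.
  apply (is_derive_plus (K := R_AbsRing) (V := R_NormedModule)
           (fun u => c * f u) (fun u => d * g u)); apply is_derive_scal; assumption.
Qed.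

Lemma C_split : forall z : C, z = (Re z, Im z).
Proof. intros [x y]; reflexivity. Qed.

Lemma across_expand : forall X T s,
  across X T s = Im (X s) * Re (T s) - Re (X s) * Im (T s).
Proof. intros X T s; unfold across, dot2, Re, Im; simpl; ring. Qed.

Lemma along_expand : forall X T s,
  along X T s = Re (X s) * Re (T s) + Im (X s) * Im (T s).
Proof. reflexivity. Qed.

Lemma Cmod_sqr : forall z : C, Cmod z ^ 2 = Re z ^ 2 + Im z ^ 2.
Proof.
  intros z; unfold Cmod; apply pow2_sqrt; unfold Re, Im.
  generalize (pow2_ge_0 (fst z)) (pow2_ge_0 (snd z)); lra.
Qed.

Lemma Cmod_one : forall z : C, Cmod z = 1 <-> Re z ^ 2 + Im z ^ 2 = 1.
Proof.
  intros z; rewrite <- Cmod_sqr; split; intros E.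
  - rewrite E; ring.
  - generalize (Cmod_ge_0 z); intros P; nra.
Qed.

Lemma C_expi_of_unit : forall z : C, Re z ^ 2 + Im z ^ 2 = 1 ->
  exists a, z = expi a.
Proof.
  intros [x y]; unfold Re, Im, expi; simpl fst; simpl snd; intros E.
  assert (B : -1 <= x <= 1) by (split; nra).
  destruct (Rle_or_lt 0 y) as [P | P].
  - exists (acos x); rewrite cos_acos, sin_acos by exact B; f_equal.
    rewrite <- (sqrt_Rsqr y P); f_equal; unfold Rsqr; lra.
  - exists (- acos x); rewrite cos_neg, sin_neg, cos_acos, sin_acos by exact B.
    f_equal; rewrite <- (Ropp_involutive y) at 1; f_equal.
    rewrite <- (sqrt_Rsqr (- y)) by lra; f_equal; unfold Rsqr; lra.
Qed.

(** * Regularity of solutions *)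

(** [ex_derive_n] with the recursion on the side of [Derive f], which turns
    closure under products and inverses into an induction on [n]. *)
Fixpoint differentiable_times (n : nat) (f : R -> R) : Prop :=
  match n with
  | O => True
  | S m => (forall s, ex_derive f s) /\ differentiable_times m (Derive f)
  end.

Lemma differentiable_times_le : forall n f,
  differentiable_times (S n) f -> differentiable_times n f.
Proof.
  induction n as [|n IH]; intros f Hf; [exact I|].
  destruct Hf as [H0 H1]; split; [exact H0 | apply IH; exact H1].
Qed.

Lemma differentiable_times_const : forall n c,
  differentiable_times n (fun _ => c).
Proof.
  induction n as [|n IH]; intros c; [exact I|]; split.
  - intros s; apply ex_derive_const.
  - replace (Derive (fun _ : R => c)) with (fun _ : R => 0); [apply IH|].
    apply functional_extensionality; intros s; symmetry; apply Derive_const.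
Qed.

Lemma differentiable_times_plus : forall n f g,
  differentiable_times n f -> differentiable_times n g ->
  differentiable_times n (fun s => f s + g s).
Proof.
  induction n as [|n IH]; intros f g Hf Hg; [exact I|].
  destruct Hf as [Hf0 Hf1]; destruct Hg as [Hg0 Hg1]; split.
  - intros s; exact (ex_derive_plus f g s (Hf0 s) (Hg0 s)).
  - replace (Derive (fun s => f s + g s)) with (fun s => Derive f s + Derive g s);
      [apply IH; assumption|].
    apply functional_extensionality; intros s; symmetry.
    apply Derive_plus; auto.
Qed.

Lemma differentiable_times_opp : forall n f,
  differentiable_times n f -> differentiable_times n (fun s => - f s).
Proof.
  induction n as [|n IH]; intros f Hf; [exact I|].
  destruct Hf as [Hf0 Hf1]; split.
  - intros s; exact (ex_derive_opp f s (Hf0 s)).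
  - replace (Derive (fun s => - f s)) with (fun s => - Derive f s);
      [apply IH; assumption|].
    apply functional_extensionality; intros s; symmetry; apply Derive_opp.
Qed.

Lemma differentiable_times_mult : forall n f g,
  differentiable_times n f -> differentiable_times n g ->
  differentiable_times n (fun s => f s * g s).
Proof.
  induction n as [|n IH]; intros f g Hf Hg; [exact I|].
  assert (Kf := differentiable_times_le _ _ Hf).
  assert (Kg := differentiable_times_le _ _ Hg).
  destruct Hf as [Hf0 Hf1]; destruct Hg as [Hg0 Hg1]; split.
  - intros s; exact (ex_derive_mult f g s (Hf0 s) (Hg0 s)).
  - replace (Derive (fun s => f s * g s))
      with (fun s => Derive f s * g s + f s * Derive g s).
    + apply differentiable_times_plus; apply IH; assumption.
    + apply functional_extensionality; intros s; symmetry.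
      apply Derive_mult; auto.
Qed.

(** In the derivative [- f' / f ^ 2] the function [1 / f] reappears, with one
    derivative fewer to be found. *)
Lemma differentiable_times_inv : forall n f,
  (forall s, f s <> 0) ->
  differentiable_times n f -> differentiable_times n (fun s => / f s).
Proof.
  induction n as [|n IH]; intros f Nf Hf; [exact I|].
  assert (Kf := differentiable_times_le _ _ Hf).
  destruct Hf as [Hf0 Hf1]; split.
  - intros s; exact (ex_derive_inv f s (Hf0 s) (Nf s)).
  - replace (Derive (fun s => / f s))
      with (fun s => - Derive f s * (/ f s * / f s)).
    + apply differentiable_times_mult;
        [apply differentiable_times_opp; assumption|].
      apply differentiable_times_mult; apply IH; assumption.
    + apply functional_extensionality; intros s; symmetry.
      rewrite Derive_inv by auto; field; auto.
Qed.

Lemma differentiable_times_of_derivative : forall n f g,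
  (forall s, is_derive f s (g s)) -> differentiable_times n g ->
  differentiable_times (S n) f.
Proof.
  intros n f g H Hg; split.
  - intros s; exists (g s); apply H.
  - replace (Derive f) with g; [exact Hg|].
    apply functional_extensionality; intros s; symmetry.
    apply is_derive_unique, H.
Qed.

Lemma ex_derive_n_of_differentiable_times : forall f,
  (forall n, differentiable_times n f) -> forall n s, ex_derive_n f n s.
Proof.
  intros f Hf [|n] s; [exact I|].
  generalize (Hf (S n)); clear Hf; revert f.
  induction n as [|n IH]; intros f Hf; [apply Hf|].
  apply (ex_derive_ext (Derive_n (Derive f) n)).
  - intros t.
    change (Derive_n (Derive_n f 1) n t = Derive_n f (S n) t).
    rewrite Derive_n_comp; f_equal; lia.
  - apply IH, Hf.
Qed.

Lemma bend_denominator_pos : forall h t n, 0 < h -> 0 < t ^ 2 + n ^ 2 + h ^ 2.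
Proof. intros h t n Hh; nra. Qed.

Lemma framed_tangent : forall X T k, framed_curve X T k ->
  forall s, tangent X s = T s.
Proof.
  intros X T k HX s; unfold tangent, D2; rewrite (C_split (T s)); f_equal;
    apply is_derive_unique; apply HX.
Qed.

Lemma framed_tau : forall X T k, framed_curve X T k ->
  forall s, tau X s = along X T s.
Proof.
  intros X T k HX s; unfold tau; rewrite (framed_tangent _ _ _ HX); reflexivity.
Qed.

Lemma framed_nu : forall X T k, framed_curve X T k ->
  forall s, nu X s = across X T s.
Proof.
  intros X T k HX s; unfold nu, normal; rewrite (framed_tangent _ _ _ HX);
    reflexivity.
Qed.

Lemma framed_curvature : forall X T k, framed_curve X T k ->
  forall s, curvature X s = k s.
Proof.
  intros X T k HX s; unfold curvature, normal.
  replace (D2 X) with T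
    by (apply functional_extensionality; intros u; symmetry;
        apply (framed_tangent _ _ _ HX)).
  rewrite (framed_tangent _ _ _ HX).
  assert (E2 : D2 T s = (- k s * Im (T s), k s * Re (T s))).
  { unfold D2; f_equal; apply is_derive_unique; apply HX. }
  rewrite E2; clear E2.
  generalize (fc_unit _ _ _ HX s); unfold dot2, Re, Im; simpl; intros E.
  transitivity (k s * (fst (T s) ^ 2 + snd (T s) ^ 2)); [ring|].
  replace (fst (T s) ^ 2 + snd (T s) ^ 2) with 1 by (rewrite <- E; ring); ring.
Qed.

(** Bootstrapping: the derivatives of the four coordinates are rational functions
    of these coordinates with a positive denominator, so each order of
    differentiability gives the next one. *)
Lemma profile_differentiable : forall h X T, 0 < h -> profile_solution h X T ->
  forall n,
  (differentiable_times n (fun s => Re (X s)) /\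
   differentiable_times n (fun s => Im (X s))) /\
  (differentiable_times n (fun s => Re (T s)) /\
   differentiable_times n (fun s => Im (T s))).
Proof.
  intros h X T Hh HX; induction n as [|n [[Hx Hy] [Ha Hb]]]; [repeat split; exact I|].
  assert (Ht : differentiable_times n (along X T)).
  { apply differentiable_times_plus; apply differentiable_times_mult; assumption. }
  assert (Hn : differentiable_times n (across X T)).
  { replace (across X T)
      with (fun s => Im (X s) * Re (T s) + - (Re (X s) * Im (T s))).
    - apply differentiable_times_plus; [|apply differentiable_times_opp];
        apply differentiable_times_mult; assumption.
    - apply functional_extensionality; intros s; rewrite across_expand; ring. }
  assert (Hk : differentiable_times n
                 (fun s => bend h (along X T s) (across X T s))).
  { unfold bend, Rdiv; simpl pow.
    apply differentiable_times_mult; [|apply differentiable_times_inv].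
    - apply differentiable_times_plus; [|apply differentiable_times_opp; assumption].
      repeat first [ assumption | apply differentiable_times_const
                   | apply differentiable_times_mult
                   | apply differentiable_times_plus ].
    - intros s; apply Rgt_not_eq; exact (bend_denominator_pos h _ _ Hh).
    - repeat first [ assumption | apply differentiable_times_const
                   | apply differentiable_times_mult
                   | apply differentiable_times_plus ]. }
  split; split.
  - exact (differentiable_times_of_derivative _ _ _ (fc_ReX _ _ _ HX) Ha).
  - exact (differentiable_times_of_derivative _ _ _ (fc_ImX _ _ _ HX) Hb).
  - refine (differentiable_times_of_derivative _ _ _ (fc_ReT _ _ _ HX) _).
    apply differentiable_times_mult; [apply differentiable_times_opp|]; assumption.
  - refine (differentiable_times_of_derivative _ _ _ (fc_ImT _ _ _ HX) _).
    apply differentiable_times_mult; assumption.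
Qed.

Lemma profile_arclength : forall h X T, 0 < h -> profile_solution h X T ->
  arclength_curve X.
Proof.
  intros h X T Hh HX; split.
  - intros n s; split; apply ex_derive_n_of_differentiable_times;
      intros m; apply (profile_differentiable h X T Hh HX m).
  - intros s; change (Cmod (tangent X s) = 1); rewrite (framed_tangent _ _ _ HX).
    apply Cmod_one, (fc_unit _ _ _ HX).
Qed.

(** * The rotator equation *)

(** Unit speed makes the acceleration orthogonal to the tangent, so that it is
    determined by its normal component, the curvature. *)
Lemma arclength_framed : forall X, arclength_curve X ->
  framed_curve X (tangent X) (curvature X).
Proof.
  intros X [HS HU].
  assert (U : forall s, Re (tangent X s) ^ 2 + Im (tangent X s) ^ 2 = 1)
    by (intros s; apply Cmod_one, HU).
  assert (Da : forall s, is_derive (fun u => Re (tangent X u)) s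
                           (Re (D2 (D2 X) s))).
  { intros s; apply Derive_correct; exact (proj1 (HS 2%nat s)). }
  assert (Db : forall s, is_derive (fun u => Im (tangent X u)) s
                           (Im (D2 (D2 X) s))).
  { intros s; apply Derive_correct; exact (proj2 (HS 2%nat s)). }
  assert (P : forall s, Re (tangent X s) * Re (D2 (D2 X) s)
                        + Im (tangent X s) * Im (D2 (D2 X) s) = 0).
  { intros s.
    assert (D : is_derive (fun u => Re (tangent X u) ^ 2 + Im (tangent X u) ^ 2) s
                  (2 * (Re (tangent X s) * Re (D2 (D2 X) s)
                        + Im (tangent X s) * Im (D2 (D2 X) s)))).
    { apply (is_derive_ext (fun u => Re (tangent X u) * Re (tangent X u)
                                     + Im (tangent X u) * Im (tangent X u)));
        [intros u; simpl; real_ring|].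
      apply (is_derive_eq _ _ _ _ (is_derive_plus _ _ _ _ _
               (is_derive_product _ _ _ _ _ (Da s) (Da s))
               (is_derive_product _ _ _ _ _ (Db s) (Db s)))).
      unfold plus; simpl; ring. }
    apply is_derive_unique in D.
    rewrite (Derive_ext _ (fun _ => 1)), Derive_const in D by apply U; lra. }
  assert (A : forall p q a b, a ^ 2 + b ^ 2 = 1 -> a * p + b * q = 0 ->
            p = - (p * (0 * a - 1 * b) + q * (0 * b + 1 * a)) * b /\
            q = (p * (0 * a - 1 * b) + q * (0 * b + 1 * a)) * a).
  { intros p q a b E F; split.
    - transitivity (p * (a ^ 2 + b ^ 2) - a * (a * p + b * q));
        [rewrite E, F|]; ring.
    - transitivity (q * (a ^ 2 + b ^ 2) - b * (a * p + b * q));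
        [rewrite E, F|]; ring. }
  split.
  - intros s; apply Derive_correct; exact (proj1 (HS 1%nat s)).
  - intros s; apply Derive_correct; exact (proj2 (HS 1%nat s)).
  - intros s; apply (is_derive_eq _ _ _ _ (Da s)).
    exact (proj1 (A _ _ _ _ (U s) (P s))).
  - intros s; apply (is_derive_eq _ _ _ _ (Db s)).
    exact (proj2 (A _ _ _ _ (U s) (P s))).
  - exact U.
Qed.

Lemma framed_along_derive : forall X T k, framed_curve X T k ->
  forall s, is_derive (along X T) s (1 + k s * across X T s).
Proof.
  intros X T k HX s.
  apply (is_derive_eq _ _ _ _
    (is_derive_plus _ _ _ _ _
       (is_derive_product _ _ _ _ _ (fc_ReX _ _ _ HX s) (fc_ReT _ _ _ HX s))
       (is_derive_product _ _ _ _ _ (fc_ImX _ _ _ HX s) (fc_ImT _ _ _ HX s)))).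
  rewrite across_expand, <- (fc_unit _ _ _ HX s); unfold plus; simpl; ring.
Qed.

Lemma framed_across_derive : forall X T k, framed_curve X T k ->
  forall s, is_derive (across X T) s (- k s * along X T s).
Proof.
  intros X T k HX s.
  apply (is_derive_ext
    (fun u => Im (X u) * Re (T u) + Re (X u) * (- 1 * Im (T u)))).
  { intros u; rewrite across_expand; real_ring. }
  apply (is_derive_eq _ _ _ _
    (is_derive_plus _ _ _ _ _
       (is_derive_product _ _ _ _ _ (fc_ImX _ _ _ HX s) (fc_ReT _ _ _ HX s))
       (is_derive_product _ _ _ _ _ (fc_ReX _ _ _ HX s)
         (is_derive_scal _ _ (- 1) _ (fc_ImT _ _ _ HX s))))).
  rewrite along_expand; unfold plus; simpl; ring.
Qed.

Lemma framed_rotate : forall X T k a, framed_curve X T k ->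
  framed_curve (fun s => expi a * X s)%C (fun s => expi a * T s)%C k.
Proof.
  intros X T k a HX; split; intros s.
  - apply (is_derive_ext (fun u => cos a * Re (X u) + - sin a * Im (X u)));
      [intros u; simpl; unfold Re, Im; real_ring|].
    apply (is_derive_eq _ _ _ _ (is_derive_lincomb _ _ _ _ _ _ _
             (fc_ReX _ _ _ HX s) (fc_ImX _ _ _ HX s))).
    simpl; unfold Re, Im; ring.
  - apply (is_derive_ext (fun u => cos a * Im (X u) + sin a * Re (X u)));
      [intros u; simpl; unfold Re, Im; real_ring|].
    apply (is_derive_eq _ _ _ _ (is_derive_lincomb _ _ _ _ _ _ _
             (fc_ImX _ _ _ HX s) (fc_ReX _ _ _ HX s))).
    simpl; unfold Re, Im; ring.
  - apply (is_derive_ext (fun u => cos a * Re (T u) + - sin a * Im (T u)));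
      [intros u; simpl; unfold Re, Im; real_ring|].
    apply (is_derive_eq _ _ _ _ (is_derive_lincomb _ _ _ _ _ _ _
             (fc_ReT _ _ _ HX s) (fc_ImT _ _ _ HX s))).
    simpl; unfold Re, Im; ring.
  - apply (is_derive_ext (fun u => cos a * Im (T u) + sin a * Re (T u)));
      [intros u; simpl; unfold Re, Im; real_ring|].
    apply (is_derive_eq _ _ _ _ (is_derive_lincomb _ _ _ _ _ _ _
             (fc_ImT _ _ _ HX s) (fc_ReT _ _ _ HX s))).
    simpl; unfold Re, Im; ring.
  - rewrite <- (fc_unit _ _ _ HX s); simpl; unfold Re, Im.
    generalize (sin2_cos2 a); unfold Rsqr.
    generalize (cos a) (sin a); intros c d E.
    transitivity ((d * d + c * c) * (fst (T s) ^ 2 + snd (T s) ^ 2)); [ring|].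
    rewrite E; ring.
Qed.

Lemma dot2_rotate : forall a z w, dot2 (expi a * z)%C (expi a * w)%C = dot2 z w.
Proof.
  intros a z w; unfold dot2, Re, Im; simpl.
  generalize (sin2_cos2 a); unfold Rsqr.
  generalize (cos a) (sin a); intros c d E.
  transitivity ((d * d + c * c) * (fst z * fst w + snd z * snd w)); [ring|].
  rewrite E; ring.
Qed.

Lemma along_rotate : forall a X T s,
  along (fun s => expi a * X s)%C (fun s => expi a * T s)%C s = along X T s.
Proof. intros; apply dot2_rotate. Qed.

Lemma across_rotate : forall a X T s,
  across (fun s => expi a * X s)%C (fun s => expi a * T s)%C s = across X T s.
Proof.
  intros a X T s; unfold across; rewrite <- (dot2_rotate a (X s)); f_equal.
  unfold Ci, expi; rewrite (C_split (T s)); unfold Cmult; simpl; f_equal; ring.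
Qed.

Lemma helicoid_s : forall h X T k, framed_curve X T k -> forall s t,
  surf_s (helicoidal_surface h X) s t = ((expi t * T s)%C, 0).
Proof.
  intros h X T k HX s t.
  assert (F := framed_rotate X T k t HX).
  unfold surf_s, D3, helicoidal_surface; simpl fst; simpl snd.
  rewrite Derive_const; f_equal.
  exact (framed_tangent _ _ _ F s).
Qed.

Lemma expi_derive : forall z t,
  is_derive (fun u => Re (expi u * z)%C) t (Re (Ci * (expi t * z))%C) /\
  is_derive (fun u => Im (expi u * z)%C) t (Im (Ci * (expi t * z))%C).
Proof.
  intros [x y] t; simpl; unfold Re, Im; simpl.
  split; auto_derive; trivial; ring.
Qed.

Lemma expi_D2 : forall z t,
  D2 (fun u => expi u * z)%C t = (Ci * (expi t * z))%C.
Proof.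
  intros z t; rewrite (C_split (Ci * (expi t * z))%C); unfold D2; f_equal;
    apply is_derive_unique; apply expi_derive.
Qed.

Lemma helicoid_t : forall h X s t,
  surf_t (helicoidal_surface h X) s t = ((Ci * (expi t * X s))%C, h).
Proof.
  intros h X s t; unfold surf_t, D3, helicoidal_surface; simpl fst; simpl snd.
  f_equal.
  - apply expi_D2.
  - apply is_derive_unique; auto_derive; trivial; ring.
Qed.

(** The cross product of the two coordinate fields, before normalization. *)
Definition helicoid_normal (h : R) (X T : R -> C) (s t : R) : R3 :=
  (((h * Re (Ci * (expi t * T s))%C), h * Im (Ci * (expi t * T s))%C),
   - along X T s).

Lemma helicoid_unit_normal : forall h X T k, framed_curve X T k ->
  unit_normal (helicoidal_surface h X)
  = fun s t => scal3 (/ sqrt (along X T s ^ 2 + h ^ 2)) (helicoid_normal h X T s t).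
Proof.
  intros h X T k HX.
  apply functional_extensionality; intros s; apply functional_extensionality; intros t.
  unfold unit_normal.
  rewrite (helicoid_s h X T k HX), helicoid_t.
  assert (E : cross3 ((Ci * (expi t * X s))%C, h) ((expi t * T s)%C, 0)
              = helicoid_normal h X T s t).
  { unfold cross3, helicoid_normal; rewrite along_expand.
    generalize (sin2_cos2 t); unfold Rsqr, Re, Im; simpl.
    generalize (cos t) (sin t); intros c d E.
    f_equal; [f_equal; ring|].
    transitivity (- ((d * d + c * c) * (fst (X s) * fst (T s) + snd (X s) * snd (T s))));
      [ring | rewrite E; ring]. }
  rewrite E; unfold norm3; f_equal; f_equal; f_equal.
  unfold helicoid_normal, dot3, dot2; generalize (along X T s); intros p.
  generalize (fc_unit _ _ _ HX s) (sin2_cos2 t); unfold Rsqr, Re, Im; simpl.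
  generalize (cos t) (sin t) (fst (T s)) (snd (T s)); intros c d a b E1 E2.
  transitivity (h * h * ((d * d + c * c) * (a * (a * 1) + b * (b * 1))) + p * p);
    [ring | rewrite E1, E2; ring].
Qed.

Lemma D3_scal : forall (q : R -> R) (m : R -> R3) s q' x y z,
  is_derive q s q' ->
  is_derive (fun u => Re (fst (m u))) s x ->
  is_derive (fun u => Im (fst (m u))) s y ->
  is_derive (fun u => snd (m u)) s z ->
  D3 (fun u => scal3 (q u) (m u)) s
  = ((q' * Re (fst (m s)) + q s * x, q' * Im (fst (m s)) + q s * y),
     q' * snd (m s) + q s * z).
Proof.
  intros q m s q' x y z Hq Hx Hy Hz; unfold D3, D2.
  f_equal; [f_equal|]; apply is_derive_unique.
  - exact (is_derive_product _ _ _ _ _ Hq Hx).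
  - exact (is_derive_product _ _ _ _ _ Hq Hy).
  - exact (is_derive_product _ _ _ _ _ Hq Hz).
Qed.

Lemma Re_Ci_mult : forall z, Re (Ci * z)%C = - Im z.
Proof. intros z; unfold Re, Im; simpl; ring. Qed.

Lemma Im_Ci_mult : forall z, Im (Ci * z)%C = Re z.
Proof. intros z; unfold Re, Im; simpl; ring. Qed.

(** The derivative [q'] of the normalizing factor only contributes a multiple of
    the normal, orthogonal to the surface, and drops out. *)
Lemma helicoid_mean_curvature : forall h X T k, 0 < h -> framed_curve X T k ->
  forall s t, mean_curvature (helicoidal_surface h X) s t
  = - h * ((along X T s ^ 2 + across X T s ^ 2 + h ^ 2) * k s + across X T s)
    / (along X T s ^ 2 + h ^ 2) * / sqrt (along X T s ^ 2 + h ^ 2).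
Proof.
  intros h X T k Hh HX s t; unfold mean_curvature.
  rewrite (helicoid_unit_normal h X T k HX).
  set (q := fun s => / sqrt (along X T s ^ 2 + h ^ 2)).
  assert (Dq : exists q', is_derive q s q').
  { eexists; unfold q.
    apply (is_derive_comp (fun p : R => / sqrt (p ^ 2 + h ^ 2)) (along X T));
      [|exact (framed_along_derive _ _ _ HX s)].
    assert (P : 0 < along X T s * (along X T s * 1) + h * (h * 1)) by nra.
    auto_derive; [split; [exact P|split; [|trivial]] | reflexivity].
    apply Rgt_not_eq, sqrt_lt_R0, P. }
  destruct Dq as [q' Dq].
  unfold surf_div.
  rewrite (helicoid_s h X T k HX), helicoid_t.
  change (/ sqrt (along X T s ^ 2 + h ^ 2)) with (q s).
  change (fun s0 t0 : R => scal3 (/ sqrt (along X T s0 ^ 2 + h ^ 2))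
                             (helicoid_normal h X T s0 t0))
    with (fun s0 t0 : R => scal3 (q s0) (helicoid_normal h X T s0 t0)).
  assert (F := framed_rotate X T k t HX).
  assert (Vs : surf_s (fun s t => scal3 (q s) (helicoid_normal h X T s t)) s t =
    ((q' * (h * Re (Ci * (expi t * T s))%C) + q s * (- h * (k s * Re (expi t * T s)%C)),
      q' * (h * Im (Ci * (expi t * T s))%C) + q s * (h * (- k s * Im (expi t * T s)%C))),
     q' * - along X T s + q s * (-1 * (1 + k s * across X T s)))).
  { unfold surf_s.
    apply (D3_scal q (fun u => helicoid_normal h X T u t)); [exact Dq| | |].
    - apply (is_derive_ext (fun u => - h * Im (expi t * T u)%C));
        [|exact (is_derive_scal _ _ _ _ (fc_ImT _ _ _ F s))].
      intros u; change (- h * Im (expi t * T u)%C = h * Re (Ci * (expi t * T u))%C).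
      rewrite Re_Ci_mult; ring.
    - apply (is_derive_ext (fun u => h * Re (expi t * T u)%C));
        [|exact (is_derive_scal _ _ _ _ (fc_ReT _ _ _ F s))].
      intros u; change (h * Re (expi t * T u)%C = h * Im (Ci * (expi t * T u))%C).
      rewrite Im_Ci_mult; reflexivity.
    - apply (is_derive_ext (fun u => -1 * along X T u));
        [|exact (is_derive_scal _ _ _ _ (framed_along_derive _ _ _ HX s))].
      intros u; unfold helicoid_normal; simpl; real_ring. }
  assert (Vt : surf_t (fun s t => scal3 (q s) (helicoid_normal h X T s t)) s t =
    ((0 * (h * Re (Ci * (expi t * T s))%C) + q s * (- h * Im (Ci * (expi t * T s))%C),
      0 * (h * Im (Ci * (expi t * T s))%C) + q s * (h * Re (Ci * (expi t * T s))%C)),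
     0 * - along X T s + q s * 0)).
  { unfold surf_t.
    apply (D3_scal (fun _ => q s) (fun u => helicoid_normal h X T s u));
      [apply (is_derive_const (q s)) | | |apply (is_derive_const (- along X T s))].
    - apply (is_derive_ext (fun u => - h * Im (expi u * T s)%C));
        [|exact (is_derive_scal _ _ _ _ (proj2 (expi_derive (T s) t)))].
      intros u; change (- h * Im (expi u * T s)%C = h * Re (Ci * (expi u * T s))%C).
      rewrite Re_Ci_mult; ring.
    - apply (is_derive_ext (fun u => h * Re (expi u * T s)%C));
        [|exact (is_derive_scal _ _ _ _ (proj1 (expi_derive (T s) t)))].
      intros u; change (h * Re (expi u * T s)%C = h * Im (Ci * (expi u * T s))%C).
      rewrite Im_Ci_mult; reflexivity. }
  rewrite Vs, Vt.
  assert (Pw : 0 < along X T s ^ 2 + h ^ 2) by nra.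
  (* In the moving frame rotated by [t], everything is a polynomial in the
     coordinates of [X s] and [T s]. *)
  generalize (fc_unit _ _ _ F s) (along_rotate t X T s) (across_rotate t X T s).
  rewrite along_expand, across_expand.
  generalize (along X T s) (across X T s) (expi t * X s)%C (expi t * T s)%C (k s).
  clear; intros p n [x y] [a b] c U Ep En.
  unfold dot3, dot2; simpl fst; simpl snd.
  rewrite !Re_Ci_mult, !Im_Ci_mult.
  unfold Re, Im in *; simpl fst in *; simpl snd in *.
  generalize (q s); intros w; change R in q'.
  assert (R2 : x ^ 2 + y ^ 2 = p ^ 2 + n ^ 2).
  { transitivity ((x ^ 2 + y ^ 2) * (a ^ 2 + b ^ 2));
      [rewrite U | rewrite <- Ep, <- En]; ring. }
  replace ((a * a + b * b + 0 * 0) * (- y * - y + x * x + h * h)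
           - (a * - y + b * x + 0 * h) ^ 2) with (p ^ 2 + h ^ 2).
  2: { transitivity ((a ^ 2 + b ^ 2) * (x ^ 2 + y ^ 2 + h ^ 2) - n ^ 2);
         [rewrite U, R2 | rewrite <- En]; ring. }
  unfold Rdiv.
  replace (- h * ((p ^ 2 + n ^ 2 + h ^ 2) * c + n) * / (p ^ 2 + h ^ 2) * w)
    with (- h * w * ((p ^ 2 + n ^ 2 + h ^ 2) * c + n) * / (p ^ 2 + h ^ 2)) by ring.
  f_equal.
  transitivity ((x ^ 2 + y ^ 2 + h ^ 2) * (- w * h * c * (a ^ 2 + b ^ 2))
                + n * (- w * h * (1 + (a ^ 2 + b ^ 2)))
                + (a ^ 2 + b ^ 2) * (w * h * n)).
  - rewrite <- En, <- Ep; ring.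
  - rewrite U, R2; ring.
Qed.

(** A rotation about the axis can be moved to the generating curve.  It leaves
    tau, nu and the curvature unchanged, so the flow equation need not be
    examined at each angle separately. *)
Lemma rotated_helicoid : forall h X theta,
  (fun s t => rotz theta (helicoidal_surface h X s t))
  = helicoidal_surface h (fun s => expi theta * X s)%C.
Proof.
  intros h X theta; apply functional_extensionality; intros s;
    apply functional_extensionality; intros t.
  unfold rotz, helicoidal_surface; simpl fst; simpl snd; f_equal.
  rewrite !Cmult_assoc, (Cmult_comm (expi theta)); reflexivity.
Qed.

Lemma rotation_velocity : forall h X theta s t,
  D3 (fun u => rotz u (helicoidal_surface h X s t)) theta
  = ((Ci * (expi t * (expi theta * X s)))%C, 0).
Proof.
  intros h X theta s t; unfold D3, rotz, helicoidal_surface; simpl fst; simpl snd.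
  f_equal; [|apply Derive_const].
  rewrite expi_D2; f_equal.
  rewrite !Cmult_assoc, (Cmult_comm (expi theta)); reflexivity.
Qed.

Lemma scal3_unit_inj : forall a b n, dot3 n n = 1 -> scal3 a n = scal3 b n -> a = b.
Proof.
  intros a b [[x y] z] U E; unfold scal3, dot3, dot2, Re, Im in *; simpl in *.
  injection E as E1 E2 E3.
  transitivity (a * (x * x + y * y + z * z)); [rewrite U; ring|].
  transitivity (b * (x * x + y * y + z * z)); [|rewrite U; ring].
  transitivity (a * x * x + a * y * y + a * z * z); [ring|].
  rewrite E1, E2, E3; ring.
Qed.

Lemma dot3_scaled_normal : forall c h p w,
  let n := scal3 c ((h * Re (Ci * w)%C, h * Im (Ci * w)%C), - p) in
  dot3 n n = c * c * (h ^ 2 * (Re w ^ 2 + Im w ^ 2) + p ^ 2).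
Proof.
  intros c h p [a b]; unfold dot3, dot2, scal3, Re, Im; simpl; ring.
Qed.

Lemma dot3_rotation_normal : forall c h p z w,
  dot3 ((Ci * z)%C, 0) (scal3 c ((h * Re (Ci * w)%C, h * Im (Ci * w)%C), - p))
  = h * dot2 z w * c.
Proof.
  intros c h p [x y] [a b]; unfold dot3, dot2, scal3, Re, Im; simpl; ring.
Qed.

(** Both sides of the flow equation are multiples of the unit normal.  Comparing
    the factors, [h * tau / w] on one side and [- H] on the other with
    [w = sqrt (tau ^ 2 + h ^ 2)], leaves an equation linear in the curvature. *)
Lemma rotator_condition : forall h X T k, 0 < h -> framed_curve X T k ->
  rotates_with_unit_speed_under_mcf (helicoidal_surface h X) <->
  forall s, k s = bend h (along X T s) (across X T s).
Proof.
  intros h X T k Hh HX.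
  assert (P : forall s, 0 < along X T s ^ 2 + h ^ 2) by (intros s; nra).
  assert (Q : forall s, 0 < along X T s ^ 2 + across X T s ^ 2 + h ^ 2)
    by (intros s; apply bend_denominator_pos, Hh).
  assert (N : forall theta s t,
    let n := unit_normal (helicoidal_surface h (fun s => expi theta * X s)%C) s t in
    dot3 n n = 1 /\
    dot3 (D3 (fun u => rotz u (helicoidal_surface h X s t)) theta) n
    = h * along X T s * / sqrt (along X T s ^ 2 + h ^ 2)).
  { intros theta s t.
    assert (F := framed_rotate X T k theta HX).
    rewrite (helicoid_unit_normal h _ _ _ F), rotation_velocity.
    rewrite along_rotate.
    assert (G := framed_rotate _ _ k t F).
    unfold helicoid_normal; rewrite dot3_scaled_normal, dot3_rotation_normal.
    rewrite (fc_unit _ _ _ G s), !dot2_rotate, along_rotate.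
    change (dot2 (X s) (T s)) with (along X T s).
    assert (W := sqrt_sqrt (along X T s ^ 2 + h ^ 2) (Rlt_le _ _ (P s))).
    assert (W0 := sqrt_lt_R0 _ (P s)).
    split; [|ring].
    replace (h ^ 2 * 1 + along X T s ^ 2)
      with (sqrt (along X T s ^ 2 + h ^ 2) * sqrt (along X T s ^ 2 + h ^ 2)) by lra.
    field; lra. }
  assert (M : forall theta s t,
    mean_curvature (helicoidal_surface h (fun s => expi theta * X s)%C) s t
    = - h * ((along X T s ^ 2 + across X T s ^ 2 + h ^ 2) * k s + across X T s)
      / (along X T s ^ 2 + h ^ 2) * / sqrt (along X T s ^ 2 + h ^ 2)).
  { intros theta s t.
    rewrite (helicoid_mean_curvature h _ _ k Hh (framed_rotate X T k theta HX)).
    rewrite along_rotate, across_rotate; reflexivity. }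
  split.
  - intros H s.
    generalize (H 0 s 0); cbv zeta; clear H.
    unfold mean_curvature_vector; rewrite rotated_helicoid.
    destruct (N 0 s 0) as [N1 N2]; rewrite N2, M; intros E.
    apply scal3_unit_inj in E; [|exact N1].
    assert (W0 := sqrt_lt_R0 _ (P s)).
    generalize (P s) (Q s); unfold bend; revert W0 E.
    generalize (sqrt (along X T s ^ 2 + h ^ 2)).
    set (D := along X T s ^ 2 + across X T s ^ 2 + h ^ 2).
    set (p := along X T s ^ 2 + h ^ 2).
    intros w W0 E Pp PD.
    assert (E' : along X T s * p = D * k s + across X T s).
    { apply (Rmult_eq_reg_l (h * / w * / p)).
      - transitivity (h * along X T s * / w); [field; lra|].
        rewrite E; field; lra.
      - assert (0 < / w) by (apply Rinv_0_lt_compat; lra).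
        assert (0 < / p) by (apply Rinv_0_lt_compat; lra).
        apply Rgt_not_eq; repeat apply Rmult_lt_0_compat; lra. }
    rewrite E'; field; lra.
  - intros H theta s t; cbv zeta.
    unfold mean_curvature_vector; rewrite rotated_helicoid.
    destruct (N theta s t) as [N1 N2]; rewrite N2, M, H; f_equal.
    assert (W0 := sqrt_lt_R0 _ (P s)).
    unfold bend; generalize (P s) (Q s); intros Ps Qs; field; lra.
Qed.

Lemma profile_generates : forall h X T, 0 < h -> profile_solution h X T ->
  generates_rotator h X.
Proof.
  intros h X T Hh HX; split; [exact (profile_arclength h X T Hh HX)|].
  apply (proj2 (rotator_condition h X T _ Hh HX)); reflexivity.
Qed.

Lemma generator_profile : forall h X, 0 < h -> generates_rotator h X ->
  profile_solution h X (tangent X).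
Proof.
  intros h X Hh [HA HR].
  assert (F := arclength_framed X HA).
  assert (E := proj1 (rotator_condition h X _ _ Hh F) HR).
  split; try apply F; intros s; rewrite <- E; apply F.
Qed.

(** * Dynamics of tau and nu *)

Lemma profile_system : forall h X T, 0 < h -> profile_solution h X T ->
  solves_tau_nu_system h (along X T) (across X T).
Proof.
  intros h X T Hh HX s; cbv zeta; split.
  - apply (is_derive_eq _ _ _ _ (framed_along_derive _ _ _ HX s)).
    generalize (bend_denominator_pos h (along X T s) (across X T s) Hh).
    unfold bend; intros P; field; lra.
  - apply (is_derive_eq _ _ _ _ (framed_across_derive _ _ _ HX s)).
    generalize (bend_denominator_pos h (along X T s) (across X T s) Hh).
    unfold bend; intros P; field; lra.
Qed.

Lemma increment_le : forall (f df : R -> R) a b c, a <= b ->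
  (forall s, a <= s <= b -> is_derive f s (df s)) ->
  (forall s, a <= s <= b -> df s <= c) ->
  f b - f a <= c * (b - a).
Proof.
  intros f df a b c Hab D L.
  destruct (MVT_gen f a b df) as [z [Hz E]].
  - rewrite Rmin_left, Rmax_right by exact Hab; intros s Hs; apply D; lra.
  - rewrite Rmin_left, Rmax_right by exact Hab; intros s Hs.
    apply continuity_pt_filterlim; apply (ex_derive_continuous f s).
    exists (df s); apply D; lra.
  - rewrite Rmin_left, Rmax_right in Hz by exact Hab.
    rewrite E; apply Rmult_le_compat_r; [lra | apply L; exact Hz].
Qed.

Lemma is_derive_affine : forall (f : R -> R) c e u l,
  is_derive f (c + e * u) l -> is_derive (fun v => f (c + e * v)) u (e * l).
Proof.
  intros f c e u l H.
  apply (is_derive_comp f (fun v : R => c + e * v)); [exact H|].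
  auto_derive; trivial; ring.
Qed.

Lemma sign_sqr : forall e, e = 1 \/ e = -1 -> e * e = 1.
Proof. intros e [-> | ->]; ring. Qed.

(** The case [e = -1] is the symmetry that exchanges the two arms; it spares a
    separate study of [s] tending to minus infinity. *)
Lemma system_affine : forall h t n c e, e = 1 \/ e = -1 ->
  solves_tau_nu_system h t n ->
  solves_tau_nu_system h (fun u => e * t (c + e * u)) (fun u => e * n (c + e * u)).
Proof.
  intros h t n c e He H u; cbv zeta.
  destruct (H (c + e * u)) as [Dt Dn]; cbv zeta in Dt, Dn.
  split.
  - apply (is_derive_eq _ _ _ _
             (is_derive_scal _ _ e _ (is_derive_affine _ _ _ _ _ Dt))).
    destruct He as [-> | ->]; unfold Rdiv;
      generalize (t (c + 1 * u)) (t (c + -1 * u)) (n (c + 1 * u)) (n (c + -1 * u));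
      intros a a' b b'; [rewrite !Rmult_1_l; ring|].
    replace ((-1 * a') ^ 2) with (a' ^ 2) by ring.
    replace ((-1 * b') ^ 2) with (b' ^ 2) by ring; ring.
  - apply (is_derive_eq _ _ _ _
             (is_derive_scal _ _ e _ (is_derive_affine _ _ _ _ _ Dn))).
    destruct He as [-> | ->]; unfold Rdiv;
      generalize (t (c + 1 * u)) (t (c + -1 * u)) (n (c + 1 * u)) (n (c + -1 * u));
      intros a a' b b'; [rewrite !Rmult_1_l; ring|].
    replace ((-1 * a') ^ 2) with (a' ^ 2) by ring.
    replace ((-1 * b') ^ 2) with (b' ^ 2) by ring; ring.
Qed.

Lemma radius_derive : forall h t n, 0 < h -> solves_tau_nu_system h t n ->
  forall s, is_derive (fun u => t u ^ 2 + n u ^ 2) s (2 * t s).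
Proof.
  intros h t n Hh H s; destruct (H s) as [Dt Dn]; cbv zeta in Dt, Dn.
  apply (is_derive_ext (fun u => t u * t u + n u * n u));
    [intros u; simpl; real_ring|].
  apply (is_derive_eq _ _ _ _ (is_derive_plus _ _ _ _ _
           (is_derive_product _ _ _ _ _ Dt Dt) (is_derive_product _ _ _ _ _ Dn Dn))).
  generalize (bend_denominator_pos h (t s) (n s) Hh); intros P.
  unfold plus; simpl; field; lra.
Qed.

(** The main monotone quantity.  Subtracting the primitive [atan (t / h) / h] of
    [1 / (t ^ 2 + h ^ 2)] along [t] removes from the derivative of [n] the term
    [t * n], the only one without a definite sign, at the price of a bounded
    correction. *)
Lemma potential_derive : forall h t n, 0 < h -> solves_tau_nu_system h t n ->
  forall s, is_derive (fun u => n u - atan (t u / h) / h) s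
              (- ((1 + t s ^ 2 * (t s ^ 2 + h ^ 2)) / (t s ^ 2 + n s ^ 2 + h ^ 2))).
Proof.
  intros h t n Hh H s; destruct (H s) as [Dt Dn]; cbv zeta in Dt, Dn.
  assert (Da : forall p, is_derive (fun p : R => - (atan (p / h) / h)) p
                           (- / (p ^ 2 + h ^ 2))).
  { intros p; auto_derive; [trivial|].
    generalize (bend_denominator_pos h p 0 Hh); intros P; field; split; nra. }
  apply (is_derive_eq _ _ _ _ (is_derive_plus _ _ _ _ _ Dn
           (is_derive_comp _ _ _ _ _ (Da (t s)) Dt))).
  unfold plus, scal, mult; simpl; unfold mult; simpl.
  generalize (bend_denominator_pos h (t s) (n s) Hh)
    (bend_denominator_pos h (t s) 0 Hh); intros P P0.
  field; split; nra.
Qed.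

Lemma atan_quotient_bound : forall h x, 0 < h -> Rabs (atan x / h) <= PI / 2 / h.
Proof.
  intros h x Hh; unfold Rdiv at 1; rewrite Rabs_mult.
  rewrite (Rabs_pos_eq (/ h)) by (left; apply Rinv_0_lt_compat; exact Hh).
  apply Rmult_le_compat_r; [left; apply Rinv_0_lt_compat; exact Hh|].
  apply Rabs_le; generalize (atan_bound x); lra.
Qed.

(** If the potential [W] were bounded below, [n] would be bounded, since [W]
    differs from it by a bounded function; its rate of decrease
    [(1 + t ^ 2 (t ^ 2 + h ^ 2)) / (t ^ 2 + n ^ 2 + h ^ 2)] would then be bounded
    away from 0, for small as well as for large [t]. *)
Lemma nu_tends_to_minus_infinity : forall h t n, 0 < h ->
  solves_tau_nu_system h t n ->
  forall B, exists S, 0 <= S /\ forall s, S <= s -> n s <= - B.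
Proof.
  intros h t n Hh H B.
  set (W := fun u => n u - atan (t u / h) / h).
  assert (DW := potential_derive h t n Hh H); fold W in DW.
  assert (NW : forall s, Rabs (n s - W s) <= PI / 2 / h).
  { intros s; unfold W.
    replace (n s - (n s - atan (t s / h) / h)) with (atan (t s / h) / h) by ring.
    apply atan_quotient_bound, Hh. }
  assert (MW : forall a b, a <= b -> W b <= W a).
  { intros a b Hab.
    generalize (increment_le W _ a b 0 Hab (fun s _ => DW s)).
    intros K; cut (W b - W a <= 0 * (b - a)); [lra|]; apply K.
    intros s _.
    generalize (bend_denominator_pos h (t s) (n s) Hh); intros P.
    assert (0 <= (1 + t s ^ 2 * (t s ^ 2 + h ^ 2)) / (t s ^ 2 + n s ^ 2 + h ^ 2));
      [|lra].
    apply Rdiv_le_0_compat; [nra | exact P]. }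
  set (B1 := B + PI / 2 / h).
  destruct (classic (exists S, 0 <= S /\ W S <= - B1)) as [[S [S0 HS]] | No].
  - exists S; split; [exact S0|]; intros s Hs.
    generalize (MW S s Hs) (NW s); intros M N; apply Rabs_le_between in N.
    unfold B1 in HS; lra.
  - exfalso.
    assert (LW : forall s, 0 <= s -> - B1 < W s).
    { intros s Hs; apply Rnot_le_lt; intros L; apply No; exists s; split; assumption. }
    set (B2 := Rabs (W 0) + Rabs B1 + PI / 2 / h).
    assert (BN : forall s, 0 <= s -> n s ^ 2 <= B2 ^ 2).
    { intros s Hs; apply pow_maj_Rabs.
      generalize (NW s) (MW 0 s Hs) (LW s Hs); intros N M L.
      apply Rabs_le_between in N.
      generalize (Rle_abs (W 0)) (Rle_abs B1) (Rabs_pos (W 0)) (Rabs_pos B1); intros.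
      apply Rabs_le; unfold B2; lra. }
    (* [1 / m] bounds the rate from below: the summand [/ h ^ 2] of [m] pays for
       the term [t ^ 2] of the denominator, the rest for [n ^ 2 + h ^ 2]. *)
    set (m := / h ^ 2 + B2 ^ 2 + h ^ 2).
    assert (Ph : 0 < / h ^ 2) by (apply Rinv_0_lt_compat; nra).
    assert (Pm : 0 < m) by (unfold m; nra).
    assert (Rate : forall s, 0 <= s ->
      - ((1 + t s ^ 2 * (t s ^ 2 + h ^ 2)) / (t s ^ 2 + n s ^ 2 + h ^ 2)) <= - / m).
    { intros s Hs; apply Ropp_le_contravar.
      generalize (bend_denominator_pos h (t s) (n s) Hh); intros P.
      apply (Rmult_le_reg_r (m * (t s ^ 2 + n s ^ 2 + h ^ 2)));
        [apply Rmult_lt_0_compat; assumption|].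
      field_simplify; [|lra|lra].
      assert (Eh : / h ^ 2 * h ^ 2 = 1) by (field; lra).
      assert (T2 : 0 <= t s ^ 2) by apply pow2_ge_0.
      generalize (BN s Hs); intros Bs.
      assert (K1 : t s ^ 2 <= m * (t s ^ 2 * h ^ 2)).
      { replace (t s ^ 2) with (t s ^ 2 * (/ h ^ 2 * h ^ 2)) at 1 by (rewrite Eh; ring).
        replace (m * (t s ^ 2 * h ^ 2)) with (t s ^ 2 * (m * h ^ 2)) by ring.
        apply Rmult_le_compat_l; [exact T2|].
        apply Rmult_le_compat_r; [nra|]; unfold m; nra. }
      assert (K2 : n s ^ 2 + h ^ 2 <= m) by (unfold m; lra).
      assert (K3 : 0 <= m * (t s ^ 2 * t s ^ 2)) by (apply Rmult_le_pos; nra).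
      lra. }
    set (s1 := (W 0 + B1) * m).
    assert (P1 : 0 <= s1).
    { generalize (LW 0 (Rle_refl 0)); intros L; apply Rmult_le_pos; lra. }
    generalize (increment_le W _ 0 s1 (- / m) P1 (fun s _ => DW s)
                  (fun s Hs => Rate s (proj1 Hs))) (LW s1 P1).
    replace (- / m * (s1 - 0)) with (- (W 0 + B1)) by (unfold s1; field; lra).
    lra.
Qed.

(** The integrating factor: [u * exp (- P)] is increasing when [P' = q]. *)
Lemma positive_after : forall (q u du : R -> R) s0,
  (forall s, continuous q s) ->
  (forall s, is_derive u s (du s)) ->
  (forall s, s0 <= s -> q s * u s < du s) ->
  0 <= u s0 ->
  forall s, s0 < s -> 0 < u s.
Proof.
  intros q u du s0 Cq Du L U0 s Hs.
  set (P := fun s => RInt q s0 s).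
  assert (DP : forall v, is_derive P v (q v)).
  { intros v; apply (is_derive_RInt q P s0); [|apply Cq].
    apply filter_forall; intros y; apply (RInt_correct q s0 y).
    apply ex_RInt_continuous; intros z _; apply Cq. }
  assert (DG : forall v, is_derive (fun v => u v * exp (- P v)) v
                 ((du v - q v * u v) * exp (- P v))).
  { intros v.
    apply (is_derive_eq _ _ _ _ (is_derive_product _ _ _ _ _ (Du v)
             (is_derive_comp exp (fun v => - P v) v _ _ (is_derive_exp _)
                (is_derive_opp _ _ _ (DP v))))).
    unfold scal, opp, mult; simpl; unfold mult; simpl; ring. }
  destruct (MVT_gen (fun v => u v * exp (- P v)) s0 s _ (fun v _ => DG v))
    as [z [Hz E]].
  { intros v _; apply continuity_pt_filterlim.
    apply (ex_derive_continuous (fun v => u v * exp (- P v)) v).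
    eexists; apply DG. }
  rewrite Rmin_left, Rmax_right in Hz by lra.
  generalize (exp_pos (- P s)) (exp_pos (- P s0)) (exp_pos (- P z)) (L z (proj1 Hz)).
  intros E1 E2 E3 Lz.
  assert (0 < (du z - q z * u z) * exp (- P z) * (s - s0))
    by (repeat apply Rmult_lt_0_compat; lra).
  assert (0 <= u s0 * exp (- P s0)) by (apply Rmult_le_pos; lra).
  apply (Rmult_lt_reg_r (exp (- P s))); [exact E1|]; simpl in E; lra.
Qed.

Lemma system_ex_derive : forall h t n, solves_tau_nu_system h t n ->
  forall s, ex_derive t s /\ ex_derive n s.
Proof.
  intros h t n H s; destruct (H s) as [Dt Dn]; split; eexists; eassumption.
Qed.

(** The equation for [t] has the form [t' = A + (A * n) * t] with [A > 0]. *)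
Lemma tau_positive_after_zero : forall h t n s0, 0 < h ->
  solves_tau_nu_system h t n -> t s0 = 0 -> forall s, s0 < s -> 0 < t s.
Proof.
  intros h t n s0 Hh H Z.
  apply (positive_after
    (fun s => (t s ^ 2 + h ^ 2) / (t s ^ 2 + n s ^ 2 + h ^ 2) * n s) t
    (fun s => (t s ^ 2 + h ^ 2) / (t s ^ 2 + n s ^ 2 + h ^ 2) * (1 + t s * n s))).
  - intros s; apply (ex_derive_continuous (V := R_NormedModule)).
    destruct (system_ex_derive h t n H s) as [Et En].
    generalize (bend_denominator_pos h (t s) (n s) Hh); intros P.
    auto_derive; repeat split; try assumption; simpl in P; lra.
  - intros s; exact (proj1 (H s)).
  - intros s _; generalize (bend_denominator_pos h (t s) (n s) Hh); intros P.
    assert (0 < (t s ^ 2 + h ^ 2) / (t s ^ 2 + n s ^ 2 + h ^ 2))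
      by (apply Rdiv_lt_0_compat; nra).
    lra.
  - lra.
Qed.

(** Otherwise [t ^ 2 + n ^ 2] would not increase, although [n] is unbounded. *)
Lemma tau_becomes_positive : forall h t n, 0 < h ->
  solves_tau_nu_system h t n -> exists s, 0 < t s.
Proof.
  intros h t n Hh H; apply NNPP; intros No.
  assert (L : forall s, 2 * t s <= 0).
  { intros s; apply Rnot_lt_le; intros P; apply No; exists s; lra. }
  destruct (nu_tends_to_minus_infinity h t n Hh H (1 + t 0 ^ 2 + n 0 ^ 2))
    as [S [S0 HS]].
  generalize (increment_le _ _ 0 S 0 S0 (fun s _ => radius_derive h t n Hh H s)
    (fun s _ => L s)) (HS S (Rle_refl S)).
  generalize (pow2_ge_0 (t 0)) (pow2_ge_0 (n 0)) (pow2_ge_0 (t S)); cbv beta; nra.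
Qed.

Lemma tau_vanishes : forall h t n, 0 < h ->
  solves_tau_nu_system h t n -> exists s0, t s0 = 0.
Proof.
  intros h t n Hh H.
  destruct (tau_becomes_positive h t n Hh H) as [a Pa].
  destruct (tau_becomes_positive h _ _ Hh
              (system_affine h t n 0 (-1) (or_intror eq_refl) H)) as [b Pb].
  destruct (IVT_gen t (0 + -1 * b) a 0) as [s0 [_ E]].
  - intros s; apply continuity_pt_filterlim.
    apply (ex_derive_continuous (V := R_NormedModule)).
    apply (system_ex_derive h t n H).
  - split; [apply Rle_trans with (1 := Rmin_l _ _); lra
           | apply Rle_trans with (2 := Rmax_r _ _); lra].
  - exists s0; exact E.
Qed.

(** Where [n <= -1] and [t > 0], [t' <= A * (1 - t)] with [A > 0], so [t] cannot
    cross a level above 1. *)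
Lemma tau_bounded_on_arm : forall h t n, 0 < h ->
  solves_tau_nu_system h t n -> t 0 = 0 ->
  exists K S, 1 <= K /\ 0 < S /\
    forall s, S <= s -> 0 < t s <= K /\ n s <= -1.
Proof.
  intros h t n Hh H Z.
  destruct (nu_tends_to_minus_infinity h t n Hh H 1) as [S0 [P0 HS]].
  set (S := S0 + 1); set (K := Rmax 1 (t S) + 1).
  assert (K1 : 2 <= K) by (unfold K; generalize (Rmax_l 1 (t S)); lra).
  assert (KS : t S + 1 <= K) by (unfold K; generalize (Rmax_r 1 (t S)); lra).
  assert (Pt : forall s, S <= s -> 0 < t s).
  { intros s Hs; apply (tau_positive_after_zero h t n 0 Hh H Z); unfold S in Hs; lra. }
  exists K, S; repeat split; try (unfold S in *; lra).
  - apply Pt; assumption.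
  - destruct (Req_dec s S) as [-> | Ns]; [lra|].
    assert (0 < K - t s); [|lra].
    apply (positive_after
      (fun s => - ((t s ^ 2 + h ^ 2) / (t s ^ 2 + n s ^ 2 + h ^ 2)))
      (fun s => K - t s)
      (fun s => - ((t s ^ 2 + h ^ 2) / (t s ^ 2 + n s ^ 2 + h ^ 2)
                   * (1 + t s * n s))) S).
    + intros v; apply (ex_derive_continuous (V := R_NormedModule)).
      destruct (system_ex_derive h t n H v) as [Et En].
      generalize (bend_denominator_pos h (t v) (n v) Hh); intros P.
      auto_derive; repeat split; try assumption; simpl in P; lra.
    + intros v.
      apply (is_derive_eq _ _ _ _ (is_derive_minus _ _ _ _ _
               (is_derive_const K v) (proj1 (H v)))).
      unfold minus, plus, opp, zero; simpl; ring.
    + intros v Hv.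
      generalize (bend_denominator_pos h (t v) (n v) Hh) (Pt v Hv); intros P Pv.
      assert (Nv : n v <= -1) by (apply HS; unfold S in Hv; lra).
      assert (0 < (t v ^ 2 + h ^ 2) / (t v ^ 2 + n v ^ 2 + h ^ 2))
        by (apply Rdiv_lt_0_compat; nra).
      rewrite Ropp_mult_distr_l_reverse; apply Ropp_lt_contravar.
      apply Rmult_lt_compat_l; [assumption | nra].
    + lra.
    + lra.
  - apply HS; unfold S in *; lra.
Qed.

Lemma vanishing_of_nu_bound : forall h t n f D S, 0 < h ->
  solves_tau_nu_system h t n -> 0 < D ->
  (forall s, S <= s -> Rabs (f s) <= D / - n s) -> is_lim f p_infty 0.
Proof.
  intros h t n f D S Hh H PD Hf; apply is_lim_spec; intros eps.
  destruct (nu_tends_to_minus_infinity h t n Hh H (D / eps + 1)) as [S1 [_ HS]].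
  exists (Rmax S S1); intros s Hs.
  assert (S < s) by (apply Rle_lt_trans with (2 := Hs), Rmax_l).
  assert (S1 < s) by (apply Rle_lt_trans with (2 := Hs), Rmax_r).
  rewrite Rminus_0_r; apply Rle_lt_trans with (1 := Hf s (Rlt_le _ _ H0)).
  generalize (HS s (Rlt_le _ _ H1)) (cond_pos eps); intros N Pe.
  assert (0 < D / eps) by (apply Rdiv_lt_0_compat; assumption).
  apply (Rmult_lt_reg_r (- n s)); [lra|].
  replace (D / - n s * - n s) with (eps * (D / eps)) by (field; lra).
  apply Rmult_lt_compat_l; lra.
Qed.

Lemma bend_bounds : forall h t n K, 0 < h -> 0 < t <= K -> 1 <= K -> n <= -1 ->
  / (t ^ 2 + n ^ 2 + h ^ 2) <= bend h t n <= (K * (K ^ 2 + h ^ 2) + 1) / - n.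
Proof.
  intros h t n K Hh [T0 TK] K1 N1.
  assert (P := bend_denominator_pos h t n Hh).
  assert (I := Rinv_0_lt_compat _ P).
  assert (A : t * (t ^ 2 + h ^ 2) <= K * (K ^ 2 + h ^ 2)).
  { assert (t ^ 2 <= K ^ 2) by nra. apply Rmult_le_compat; nra. }
  assert (A0 : 0 < t * (t ^ 2 + h ^ 2)) by (apply Rmult_lt_0_compat; nra).
  unfold bend; split.
  - rewrite <- (Rmult_1_l (/ _)); apply Rmult_le_compat_r; lra.
  - apply (Rmult_le_reg_r ((t ^ 2 + n ^ 2 + h ^ 2) * - n));
      [apply Rmult_lt_0_compat; lra|].
    replace ((t * (t ^ 2 + h ^ 2) - n) / (t ^ 2 + n ^ 2 + h ^ 2)
             * ((t ^ 2 + n ^ 2 + h ^ 2) * - n))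
      with ((t * (t ^ 2 + h ^ 2) - n) * - n) by (field; lra).
    replace ((K * (K ^ 2 + h ^ 2) + 1) / - n * ((t ^ 2 + n ^ 2 + h ^ 2) * - n))
      with ((K * (K ^ 2 + h ^ 2) + 1) * (t ^ 2 + n ^ 2 + h ^ 2)) by (field; lra).
    apply Rle_trans with ((K * (K ^ 2 + h ^ 2) + 1) * (n ^ 2)).
    + replace (n ^ 2) with (- n * - n) by ring.
      rewrite <- Rmult_assoc; apply Rmult_le_compat_r; [lra | nra].
    + apply Rmult_le_compat_l; nra.
Qed.

Lemma bend_tends_to_zero : forall h t n, 0 < h ->
  solves_tau_nu_system h t n -> t 0 = 0 ->
  is_lim (fun s => bend h (t s) (n s)) p_infty 0.
Proof.
  intros h t n Hh H Z.
  destruct (tau_bounded_on_arm h t n Hh H Z) as [K [S [K1 [S0 HB]]]].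
  apply (vanishing_of_nu_bound h t n _ (K * (K ^ 2 + h ^ 2) + 1) S Hh H).
  - apply Rplus_le_lt_0_compat; [apply Rmult_le_pos|]; nra.
  - intros s Hs; destruct (HB s Hs) as [Bt Bn].
    destruct (bend_bounds h (t s) (n s) K Hh Bt K1 Bn) as [L U].
    rewrite Rabs_pos_eq; [exact U|].
    apply Rle_trans with (2 := L); left; apply Rinv_0_lt_compat.
    apply bend_denominator_pos, Hh.
Qed.

Lemma tau_over_radius_tends_to_zero : forall h t n, 0 < h ->
  solves_tau_nu_system h t n -> t 0 = 0 ->
  is_lim (fun s => t s / sqrt (t s ^ 2 + n s ^ 2)) p_infty 0.
Proof.
  intros h t n Hh H Z.
  destruct (tau_bounded_on_arm h t n Hh H Z) as [K [S [K1 [S0 HB]]]].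
  apply (vanishing_of_nu_bound h t n _ K S Hh H); [lra|].
  intros s Hs; destruct (HB s Hs) as [Bt Bn].
  assert (Q : - n s <= sqrt (t s ^ 2 + n s ^ 2)).
  { rewrite <- (sqrt_Rsqr (- n s)) by lra.
    apply sqrt_le_1_alt; unfold Rsqr; nra. }
  rewrite Rabs_pos_eq by (apply Rdiv_le_0_compat; lra).
  apply Rmult_le_compat; try lra.
  - left; apply Rinv_0_lt_compat; lra.
  - apply Rinv_le_contravar; lra.
Qed.

(** Far out on the arm the integrand is at least [1 / (t ^ 2 + n ^ 2 + h ^ 2)],
    while the derivative of the logarithm of this denominator is at most [2 * K]
    times it; and the denominator is unbounded. *)
Lemma total_bending_diverges : forall h t n theta, 0 < h ->
  solves_tau_nu_system h t n -> t 0 = 0 ->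
  (forall s, is_derive theta s (bend h (t s) (n s))) ->
  is_lim theta p_infty p_infty.
Proof.
  intros h t n theta Hh H Z Dth.
  destruct (tau_bounded_on_arm h t n Hh H Z) as [K [S [K1 [S0 HB]]]].
  set (L := fun s => / (2 * K) * ln (t s ^ 2 + n s ^ 2 + h ^ 2)).
  assert (IK : 0 < / (2 * K)) by (apply Rinv_0_lt_compat; lra).
  assert (DL : forall s, is_derive (fun s => L s - theta s) s
    (/ (2 * K) * (2 * t s / (t s ^ 2 + n s ^ 2 + h ^ 2)) - bend h (t s) (n s))).
  { intros s; unfold L.
    assert (Dln : is_derive (fun r => ln (r + h ^ 2)) (t s ^ 2 + n s ^ 2)
                    (/ (t s ^ 2 + n s ^ 2 + h ^ 2))).
    { generalize (bend_denominator_pos h (t s) (n s) Hh).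
      generalize (t s ^ 2 + n s ^ 2); intros r P.
      auto_derive; [simpl in P; lra|]; simpl; field; simpl in P; lra. }
    assert (P := bend_denominator_pos h (t s) (n s) Hh).
    apply (is_derive_eq _ _ _ _ (is_derive_minus _ _ _ _ _
      (is_derive_scal _ _ (/ (2 * K)) _
        (is_derive_comp (fun r => ln (r + h ^ 2)) (fun s => t s ^ 2 + n s ^ 2) s
           (/ (t s ^ 2 + n s ^ 2 + h ^ 2)) _ Dln (radius_derive h t n Hh H s)))
      (Dth s))).
    unfold minus, plus, opp, scal, mult; simpl; unfold mult; simpl; field.
    simpl in P; lra. }
  assert (Comparison : forall s, S <= s -> L s - theta s <= L S - theta S).
  { intros s Hs.
    cut ((fun s => L s - theta s) s - (fun s => L s - theta s) S <= 0 * (s - S));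
      [simpl; lra|].
    apply (increment_le _ _ S s 0 Hs (fun v _ => DL v)).
    intros v [Hv _]; destruct (HB v Hv) as [Bt Bn].
    destruct (bend_bounds h (t v) (n v) K Hh Bt K1 Bn) as [B _].
    assert (P := bend_denominator_pos h (t v) (n v) Hh).
    apply Rle_minus, Rle_trans with (2 := B).
    replace (/ (2 * K) * (2 * t v / (t v ^ 2 + n v ^ 2 + h ^ 2)))
      with (t v / K * / (t v ^ 2 + n v ^ 2 + h ^ 2)) by (field; lra).
    rewrite <- (Rmult_1_l (/ (t v ^ 2 + n v ^ 2 + h ^ 2))) at 2.
    apply Rmult_le_compat_r; [left; apply Rinv_0_lt_compat, P|].
    apply Rle_div_l; lra. }
  apply is_lim_spec; intros M.
  set (M' := Rmax 0 (M + 1 + L S - theta S)).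
  destruct (nu_tends_to_minus_infinity h t n Hh H (exp (2 * K * M'))) as [S1 [_ HS]].
  exists (Rmax S S1); intros s Hs.
  assert (Hs0 : S <= s) by (apply Rle_trans with (2 := Rlt_le _ _ Hs), Rmax_l).
  assert (Hs1 : S1 <= s) by (apply Rle_trans with (2 := Rlt_le _ _ Hs), Rmax_r).
  assert (M0 : 0 <= M') by apply Rmax_l.
  assert (M1 : M + 1 + L S - theta S <= M') by apply Rmax_r.
  assert (LM : M' <= L s).
  { unfold L.
    assert (E1 : 1 <= exp (2 * K * M')).
    { rewrite <- exp_0; destruct (Req_dec (2 * K * M') 0) as [-> | N]; [lra|].
      left; apply exp_increasing; assert (0 <= 2 * K * M') by nra; lra. }
    apply (Rmult_le_reg_l (2 * K)); [lra|].
    rewrite <- Rmult_assoc, Rinv_r, Rmult_1_l by lra.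
    rewrite <- (ln_exp (2 * K * M')); apply Rcomplements.ln_le; [apply exp_pos|].
    generalize (HS s Hs1); intros Ns.
    assert (exp (2 * K * M') <= n s ^ 2) by nra.
    generalize (pow2_ge_0 (t s)) (pow2_ge_0 h); lra. }
  generalize (Comparison s Hs0); lra.
Qed.

(** * The two arms *)

(** For [e = 1] this is a shift, for [e = -1] a reversal, whose tangent is
    [sign_tangent e c T]. *)
Definition reparametrize (e c : R) (X : R -> C) (u : R) : C := X (c + e * u).

Definition sign_tangent (e c : R) (T : R -> C) (u : R) : C :=
  (e * Re (T (c + e * u)), e * Im (T (c + e * u))).

Lemma along_sign : forall e c X T u,
  along (reparametrize e c X) (sign_tangent e c T) u = e * along X T (c + e * u).
Proof. intros; rewrite !along_expand; unfold reparametrize; simpl; ring. Qed.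

Lemma across_sign : forall e c X T u,
  across (reparametrize e c X) (sign_tangent e c T) u = e * across X T (c + e * u).
Proof. intros; rewrite !across_expand; unfold reparametrize; simpl; ring. Qed.

Lemma bend_sign : forall e h t n, e = 1 \/ e = -1 ->
  bend h (e * t) (e * n) = e * bend h t n.
Proof.
  intros e h t n [-> | ->]; unfold bend, Rdiv.
  - rewrite !Rmult_1_l; reflexivity.
  - replace ((-1 * t) ^ 2) with (t ^ 2) by ring.
    replace ((-1 * n) ^ 2) with (n ^ 2) by ring; ring.
Qed.

Lemma profile_reparametrize : forall h X T e c, e = 1 \/ e = -1 ->
  profile_solution h X T ->
  profile_solution h (reparametrize e c X) (sign_tangent e c T).
Proof.
  intros h X T e c He HX; assert (E2 := sign_sqr e He).
  split; intros u; try rewrite along_sign, across_sign, (bend_sign e) by exact He;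
    unfold reparametrize, sign_tangent; simpl Re; simpl Im; unfold Re, Im;
    simpl fst; simpl snd.
  - exact (is_derive_affine (fun s => Re (X s)) c e u _ (fc_ReX _ _ _ HX _)).
  - exact (is_derive_affine (fun s => Im (X s)) c e u _ (fc_ImX _ _ _ HX _)).
  - apply (is_derive_eq _ _ _ _ (is_derive_scal _ _ e _
      (is_derive_affine (fun s => Re (T s)) c e u _ (fc_ReT _ _ _ HX _)))).
    unfold Re, Im; ring.
  - apply (is_derive_eq _ _ _ _ (is_derive_scal _ _ e _
      (is_derive_affine (fun s => Im (T s)) c e u _ (fc_ImT _ _ _ HX _)))).
    unfold Re, Im; ring.
  - rewrite <- (fc_unit _ _ _ HX (c + e * u)); unfold Re, Im.
    transitivity ((e * e) * (fst (T (c + e * u)) ^ 2 + snd (T (c + e * u)) ^ 2));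
      [ring | rewrite E2; ring].
Qed.

Lemma moving_frame_expand : forall X T s, Re (T s) ^ 2 + Im (T s) ^ 2 = 1 ->
  X s = ((along X T s, across X T s) * T s)%C.
Proof.
  intros X T s U; rewrite (C_split (X s)) at 1.
  rewrite along_expand, across_expand, (C_split (T s)).
  revert U; unfold Cmult; simpl.
  generalize (Re (X s)) (Im (X s)) (Re (T s)) (Im (T s)); intros x y a b U; f_equal.
  - transitivity (x * (a * (a * 1) + b * (b * 1))); [rewrite U|]; ring.
  - transitivity (y * (a * (a * 1) + b * (b * 1))); [rewrite U|]; ring.
Qed.

Lemma Cmod_frame : forall X T s, Re (T s) ^ 2 + Im (T s) ^ 2 = 1 ->
  Cmod (X s) = sqrt (along X T s ^ 2 + across X T s ^ 2).
Proof.
  intros X T s U; rewrite (moving_frame_expand X T s U) at 1.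
  rewrite Cmod_mult; replace (Cmod (T s)) with 1 by (symmetry; apply Cmod_one, U).
  rewrite Rmult_1_r; reflexivity.
Qed.

Lemma constant_of_derive_zero : forall f : R -> R,
  (forall s, is_derive f s 0) -> forall s, f s = f 0.
Proof.
  intros f D s.
  destruct (Rle_or_lt 0 s) as [P | P]; [destruct P as [P | <-]; [|reflexivity]|].
  - symmetry; apply (eq_is_derive (V := R_NormedModule) f 0 s); [|exact P].
    intros v _; apply D.
  - apply (eq_is_derive (V := R_NormedModule) f s 0); [|exact P].
    intros v _; apply D.
Qed.

(** [expi (- theta) * T] has derivative 0. *)
Lemma tangent_turning : forall X T k theta, framed_curve X T k ->
  (forall s, is_derive theta s (k s)) ->
  exists a, forall s, T s = expi (a + theta s).
Proof.
  intros X T k theta HX Dth.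
  assert (Dc : forall s, is_derive (fun s => cos (theta s)) s (- sin (theta s) * k s)).
  { intros s; apply (is_derive_eq _ _ _ _
      (is_derive_comp cos theta s _ _ (is_derive_cos _) (Dth s))).
    unfold scal; simpl; unfold mult; simpl; ring. }
  assert (Ds : forall s, is_derive (fun s => sin (theta s)) s (cos (theta s) * k s)).
  { intros s; apply (is_derive_eq _ _ _ _
      (is_derive_comp sin theta s _ _ (is_derive_sin _) (Dth s))).
    unfold scal; simpl; unfold mult; simpl; ring. }
  assert (F : forall s,
    cos (theta s) * Re (T s) + sin (theta s) * Im (T s)
    = cos (theta 0) * Re (T 0) + sin (theta 0) * Im (T 0)).
  { apply constant_of_derive_zero; intros s.
    apply (is_derive_eq _ _ _ _ (is_derive_plus _ _ _ _ _
      (is_derive_product _ _ _ _ _ (Dc s) (fc_ReT _ _ _ HX s))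
      (is_derive_product _ _ _ _ _ (Ds s) (fc_ImT _ _ _ HX s)))).
    unfold plus; simpl; ring. }
  assert (G : forall s,
    cos (theta s) * Im (T s) + - 1 * (sin (theta s) * Re (T s))
    = cos (theta 0) * Im (T 0) + - 1 * (sin (theta 0) * Re (T 0))).
  { apply constant_of_derive_zero; intros s.
    apply (is_derive_eq _ _ _ _ (is_derive_plus _ _ _ _ _
      (is_derive_product _ _ _ _ _ (Dc s) (fc_ImT _ _ _ HX s))
      (is_derive_scal _ _ (- 1) _
        (is_derive_product _ _ _ _ _ (Ds s) (fc_ReT _ _ _ HX s))))).
    unfold plus; simpl; ring. }
  set (p := cos (theta 0) * Re (T 0) + sin (theta 0) * Im (T 0)) in *.
  set (q := cos (theta 0) * Im (T 0) + - 1 * (sin (theta 0) * Re (T 0))) in *.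
  destruct (C_expi_of_unit (p, q)) as [a Ea].
  { simpl Re; simpl Im; unfold p, q; rewrite <- (fc_unit _ _ _ HX 0).
    generalize (sin2_cos2 (theta 0)); unfold Rsqr.
    generalize (sin (theta 0)) (cos (theta 0)) (Re (T 0)) (Im (T 0)).
    intros d c x y E; transitivity ((d * d + c * c) * (x ^ 2 + y ^ 2));
      [ring | rewrite E; ring]. }
  injection Ea as Ep Eq.
  exists a; intros s; unfold expi.
  rewrite cos_plus, sin_plus, <- Ep, <- Eq, <- (F s), <- (G s), (C_split (T s)).
  generalize (sin2_cos2 (theta s)); unfold Rsqr; simpl.
  generalize (sin (theta s)) (cos (theta s)) (Re (T s)) (Im (T s)).
  intros d c x y E; f_equal.
  - transitivity ((d * d + c * c) * x); [rewrite E|]; ring.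
  - transitivity ((d * d + c * c) * y); [rewrite E|]; ring.
Qed.

Lemma polar_right_half_plane : forall t n, 0 < t ->
  (t, n) = (RtoC (sqrt (t ^ 2 + n ^ 2)) * expi (atan (n / t)))%C.
Proof.
  intros t n Pt.
  assert (Q : sqrt (t ^ 2 + n ^ 2) = t * sqrt (1 + (n / t)²)).
  { rewrite <- (sqrt_Rsqr t) at 2 by lra; rewrite <- sqrt_mult_alt by apply Rle_0_sqr.
    f_equal; unfold Rsqr; field; lra. }
  assert (P : 0 < sqrt (1 + (n / t)²)).
  { apply sqrt_lt_R0; generalize (Rle_0_sqr (n / t)); lra. }
  unfold expi, RtoC, Cmult; cbn [fst snd].
  rewrite cos_atan, sin_atan, Q; f_equal; field; lra.
Qed.

Lemma continuous_plus_R : forall (f g : R -> R) s,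
  continuous f s -> continuous g s -> continuous (fun u => f u + g u) s.
Proof.
  intros f g s Cf Cg; apply (continuous_plus (V := R_NormedModule)); assumption.
Qed.

Lemma continuous_minus_R : forall (f g : R -> R) s,
  continuous f s -> continuous g s -> continuous (fun u => f u - g u) s.
Proof.
  intros f g s Cf Cg; apply (continuous_minus (V := R_NormedModule)); assumption.
Qed.

Lemma continuous_mult_R : forall (f g : R -> R) s,
  continuous f s -> continuous g s -> continuous (fun u => f u * g u) s.
Proof.
  intros f g s Cf Cg; apply (continuous_mult (K := R_AbsRing)); assumption.
Qed.

Lemma bend_continuous : forall h (t n : R -> R) s, 0 < h ->
  continuous t s -> continuous n s -> continuous (fun u => bend h (t u) (n u)) s.
Proof.
  intros h t n s Hh Ct Cn.
  assert (Sq : forall f : R -> R, continuous f s -> continuous (fun u => f u ^ 2) s).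
  { intros f Cf; apply (continuous_ext (fun u => f u * f u));
      [intros u; simpl; real_ring | exact (continuous_mult_R f f s Cf Cf)]. }
  assert (Ch := continuous_const (h ^ 2) s).
  apply (continuous_mult_R (fun u => t u * (t u ^ 2 + h ^ 2) - n u)
           (fun u => / (t u ^ 2 + n u ^ 2 + h ^ 2))).
  - apply (continuous_minus_R (fun u => t u * (t u ^ 2 + h ^ 2))); [|exact Cn].
    apply (continuous_mult_R t (fun u => t u ^ 2 + h ^ 2)); [exact Ct|].
    exact (continuous_plus_R _ _ s (Sq t Ct) Ch).
  - apply continuous_Rinv_comp; [|apply Rgt_not_eq, (bend_denominator_pos h _ _ Hh)].
    exact (continuous_plus_R _ _ s (continuous_plus_R _ _ s (Sq t Ct) (Sq n Cn)) Ch).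
Qed.

Lemma profile_bend_continuous : forall h X T, 0 < h -> profile_solution h X T ->
  forall s, continuous (fun u => bend h (along X T u) (across X T u)) s.
Proof.
  intros h X T Hh HX s.
  destruct (system_ex_derive h _ _ (profile_system h X T Hh HX) s) as [Et En].
  apply bend_continuous; [exact Hh | |];
    apply (ex_derive_continuous (V := R_NormedModule)); assumption.
Qed.

Definition turning (h : R) (X T : R -> C) (s : R) : R :=
  RInt (fun u => bend h (along X T u) (across X T u)) 0 s.

Lemma turning_derive : forall h X T, 0 < h -> profile_solution h X T ->
  forall s, is_derive (turning h X T) s (bend h (along X T s) (across X T s)).
Proof.
  intros h X T Hh HX s.
  apply (is_derive_RInt (fun u => bend h (along X T u) (across X T u))
           (turning h X T) 0);
    [|exact (profile_bend_continuous h X T Hh HX s)].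
  apply filter_forall; intros y.
  apply (RInt_correct (fun u => bend h (along X T u) (across X T u)) 0 y).
  apply ex_RInt_continuous; intros z _; apply profile_bend_continuous; assumption.
Qed.

Lemma radius_increasing : forall h Y V, 0 < h -> profile_solution h Y V ->
  along Y V 0 = 0 -> strictly_increases_to_infinity (fun u => Cmod (Y u)).
Proof.
  intros h Y V Hh HY Z.
  assert (H := profile_system h Y V Hh HY).
  assert (E : forall u, Cmod (Y u) = sqrt (along Y V u ^ 2 + across Y V u ^ 2))
    by (intros u; apply Cmod_frame, (fc_unit _ _ _ HY)).
  assert (DR := radius_derive h _ _ Hh H).
  assert (Pt := tau_positive_after_zero h _ _ 0 Hh H Z).
  split.
  - intros u v Hu Huv; rewrite !E; apply sqrt_lt_1_alt; split.
    { generalize (pow2_ge_0 (along Y V u)) (pow2_ge_0 (across Y V u)); lra. }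
    set (m := (u + v) / 2).
    (* The derivative of the squared distance vanishes at 0, so strictness is
       obtained away from the left end only. *)
    apply Rle_lt_trans with (along Y V m ^ 2 + across Y V m ^ 2).
    + assert (L : forall s, u <= s <= m -> -1 * (2 * along Y V s) <= 0).
      { intros s Hs; destruct (Req_dec s 0) as [-> | N]; [rewrite Z; lra|].
        assert (0 < along Y V s) by (apply Pt; lra); lra. }
      assert (Hum : u <= m) by (unfold m; lra).
      generalize (increment_le (fun s => -1 * (along Y V s ^ 2 + across Y V s ^ 2))
        (fun s => -1 * (2 * along Y V s)) u m 0 Hum
        (fun s _ => is_derive_scal (fun s => along Y V s ^ 2 + across Y V s ^ 2)
                      s (-1) _ (DR s)) L).
      simpl; lra.
    + destruct (MVT_gen (fun s => along Y V s ^ 2 + across Y V s ^ 2) m v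
                  (fun s => 2 * along Y V s) (fun s _ => DR s)) as [z [Hz Ez]].
      { intros s _; apply continuity_pt_filterlim.
        apply (ex_derive_continuous (fun s => along Y V s ^ 2 + across Y V s ^ 2));
          eexists; apply DR. }
      rewrite Rmin_left, Rmax_right in Hz by (unfold m; lra).
      assert (0 < along Y V z) by (apply Pt; unfold m in Hz; lra).
      assert (0 < 2 * along Y V z * (v - m))
        by (repeat apply Rmult_lt_0_compat; unfold m; lra).
      simpl in Ez |- *; lra.
  - apply is_lim_spec; intros M.
    destruct (nu_tends_to_minus_infinity h _ _ Hh H (Rabs M + 1)) as [S [_ HS]].
    exists S; intros u Hu; rewrite E.
    apply Rlt_le_trans with (- across Y V u).
    + generalize (HS u (Rlt_le _ _ Hu)) (Rle_abs M); lra.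
    + rewrite <- (sqrt_Rsqr (- across Y V u))
        by (generalize (HS u (Rlt_le _ _ Hu)) (Rabs_pos M); lra).
      apply sqrt_le_1_alt; unfold Rsqr; generalize (pow2_ge_0 (along Y V u)); lra.
Qed.

Lemma properly_embedded_of_radius : forall Y : R -> C,
  strictly_increases_to_infinity (fun u => Cmod (Y u)) -> properly_embedded Y.
Proof.
  intros Y [Inc Lim]; split.
  - intros u v Hu Hv E.
    destruct (Rtotal_order u v) as [L | [L | L]]; [|exact L|].
    + generalize (Inc u v Hu L); rewrite E; lra.
    + generalize (Inc v u Hv L); rewrite E; lra.
  - intros M; apply is_lim_spec in Lim; destruct (Lim M) as [U HU].
    exists U; intros u _ HM; apply Rnot_lt_le; intros L.
    generalize (HU u L); lra.
Qed.

Lemma polar_angle_continuous : forall (theta t n : R -> R) a u, t u <> 0 ->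
  ex_derive theta u -> ex_derive t u -> ex_derive n u ->
  continuous (fun u => a + theta u + atan (n u / t u)) u.
Proof.
  intros theta t n a u Nz Eh Et En.
  apply (ex_derive_continuous (V := R_NormedModule)).
  auto_derive; repeat split; assumption.
Qed.

(** On the arm [tau > 0], so the polar angle of [X = (tau + i nu) T] is that of
    [T] plus [atan (nu / tau)]: it stays within a bounded distance of the turning
    angle, which diverges. *)
Lemma profile_spirals : forall h Y V, 0 < h -> profile_solution h Y V ->
  along Y V 0 = 0 -> spirals_infinitely Y.
Proof.
  intros h Y V Hh HY Z.
  assert (H := profile_system h Y V Hh HY).
  assert (Dth := turning_derive h Y V Hh HY).
  assert (Pt := tau_positive_after_zero h _ _ 0 Hh H Z).
  destruct (tangent_turning Y V _ _ HY Dth) as [a Ha].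
  exists (fun u => a + turning h Y V u + atan (across Y V u / along Y V u)).
  split.
  - intros u Hu; split.
    + destruct (system_ex_derive h _ _ H u) as [Et En].
      apply polar_angle_continuous;
        [apply Rgt_not_eq, Pt, Hu | eexists; apply Dth | exact Et | exact En].
    + rewrite (moving_frame_expand Y V u (fc_unit _ _ _ HY u)) at 1.
      rewrite (Cmod_frame Y V u (fc_unit _ _ _ HY u)).
      rewrite (polar_right_half_plane _ (across Y V u) (Pt u Hu)), (Ha u).
      rewrite <- Cmult_assoc; f_equal.
      unfold expi, Cmult; cbn [fst snd].
      rewrite (cos_plus (a + _)), (sin_plus (a + _)); f_equal; ring.
  - apply is_lim_spec; intros M.
    assert (L := total_bending_diverges h _ _ _ Hh H Z Dth).
    apply is_lim_spec in L.
    destruct (L (M + Rabs a + PI / 2)) as [S HS].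
    exists S; intros u Hu; generalize (HS u Hu); intros B.
    generalize (atan_bound (across Y V u / along Y V u)); intros A.
    generalize (Rle_abs (- a)); rewrite Rabs_Ropp; intros Ra.
    apply Rlt_le_trans with (2 := Rle_abs _); lra.
Qed.

(** The arm [e] of [X] is the arm of a solution parametrized from its closest
    point forward; its curvature and its angle pick up the sign [e]. *)
Lemma profile_arm : forall h X T s0 e, 0 < h -> e = 1 \/ e = -1 ->
  profile_solution h X T -> along X T s0 = 0 -> arm_properties X s0 e.
Proof.
  intros h X T s0 e Hh He HX Z0.
  set (Y := reparametrize e s0 X); set (V := sign_tangent e s0 T).
  assert (HY : profile_solution h Y V) by (apply profile_reparametrize; assumption).
  assert (Z : along Y V 0 = 0).
  { unfold Y, V; rewrite along_sign, Rmult_0_r, Rplus_0_r, Z0; ring. }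
  assert (H := profile_system h Y V Hh HY).
  assert (E2 := sign_sqr e He).
  assert (Ek : forall u, curvature X (s0 + e * u)
                         = e * bend h (along Y V u) (across Y V u)).
  { intros u; rewrite (framed_curvature X T _ HX); unfold Y, V.
    rewrite along_sign, across_sign, (bend_sign e) by exact He.
    rewrite <- Rmult_assoc, E2; ring. }
  assert (Inc := radius_increasing h Y V Hh HY Z).
  repeat split.
  - apply (properly_embedded_of_radius Y Inc).
  - apply (properly_embedded_of_radius Y Inc).
  - apply Inc.
  - apply Inc.
  - assert (L := total_bending_diverges h _ _ _ Hh H Z (turning_derive h Y V Hh HY)).
    assert (EK : forall U, e * turning h Y V U
                           = RInt (fun u => curvature X (s0 + e * u)) 0 U).
    { intros U; rewrite (RInt_ext _ _ _ _ (fun u _ => Ek u)); symmetry.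
      apply (RInt_scal (V := R_CompleteNormedModule)).
      apply ex_RInt_continuous; intros z _; apply profile_bend_continuous; assumption. }
    unfold infinite_total_curvature; cbv zeta.
    destruct He as [He | He]; [left | right];
      apply (is_lim_ext (fun U => e * turning h Y V U) _ _ _ EK); rewrite He.
    + apply (is_lim_ext (turning h Y V)); [intros; ring | exact L].
    + apply (is_lim_ext (fun U => - turning h Y V U)); [intros; ring|].
      exact (is_lim_opp _ _ _ L).
  - exact (profile_spirals h Y V Hh HY Z).
  - apply (is_lim_ext (fun u => e * bend h (along Y V u) (across Y V u)));
      [intros u; symmetry; apply Ek|].
    replace (Finite 0) with (Rbar_mult e 0) by (simpl; f_equal; ring).
    apply is_lim_scal_l, bend_tends_to_zero; assumption.
  - set (w := fun u => along Y V u / sqrt (along Y V u ^ 2 + across Y V u ^ 2)).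
    apply (is_lim_ext (fun u => acos (e * w u))).
    + intros u; unfold angle; rewrite (framed_tangent X T _ HX); f_equal.
      unfold w; rewrite <- (Cmod_frame Y V u (fc_unit _ _ _ HY u)).
      replace (Cmod (T (s0 + e * u))) with 1
        by (symmetry; apply Cmod_one, (fc_unit _ _ _ HX)).
      unfold Y, V; rewrite along_sign; unfold reparametrize.
      transitivity (e * e * along X T (s0 + e * u) / Cmod (X (s0 + e * u)));
        [unfold Rdiv; ring|].
      rewrite E2, along_expand; unfold dot2, Rdiv; rewrite !Rmult_1_l; f_equal; ring.
    + rewrite <- acos_0.
      apply (is_lim_comp_continuous (fun u => e * w u) acos p_infty 0).
      * replace (Finite 0) with (Rbar_mult e 0) by (simpl; f_equal; ring).
        exact (is_lim_scal_l w e _ _ (tau_over_radius_tends_to_zero h _ _ Hh H Z)).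
      * apply continuity_pt_filterlim, derivable_continuous_pt, derivable_pt_acos; lra.
Qed.

Lemma profile_arms : forall h X T, 0 < h -> profile_solution h X T ->
  exists s0, unique (closest_to_origin X) s0 /\
    arm_properties X s0 1 /\ arm_properties X s0 (- 1).
Proof.
  intros h X T Hh HX.
  destruct (tau_vanishes h _ _ Hh (profile_system h X T Hh HX)) as [s0 Z0].
  assert (A1 := profile_arm h X T s0 1 Hh (or_introl eq_refl) HX Z0).
  assert (A2 := profile_arm h X T s0 (-1) Hh (or_intror eq_refl) HX Z0).
  assert (Far : forall s, s <> s0 -> Cmod (X s0) < Cmod (X s)).
  { intros s N; destruct (Rdichotomy _ _ N) as [L | L].
    - destruct A2 as [_ [[Inc _] _]].
      generalize (Inc 0 (s0 - s) (Rle_refl 0) ltac:(lra)); unfold arm.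
      replace (s0 + -1 * 0) with s0 by ring.
      replace (s0 + -1 * (s0 - s)) with s by ring; trivial.
    - destruct A1 as [_ [[Inc _] _]].
      generalize (Inc 0 (s - s0) (Rle_refl 0) ltac:(lra)); unfold arm.
      replace (s0 + 1 * 0) with s0 by ring.
      replace (s0 + 1 * (s - s0)) with s by ring; trivial. }
  exists s0; split; [split|split; assumption].
  - intros s; destruct (Req_dec s s0) as [-> | N]; [lra | left; apply Far, N].
  - intros s Hs; symmetry; apply NNPP; intros N.
    generalize (Hs s0) (Far s N); lra.
Qed.

(** * A Picard theorem for causal functional equations *)

(** The sign [e] covers both directions of time. *)
Lemma abs_le_of_derive_bound : forall (F f b db : R -> R) e v, e = 1 \/ e = -1 ->
  0 <= v -> F 0 = 0 -> (forall s, is_derive F s (f s)) ->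
  (forall s, is_derive b s (db s)) -> 0 <= b 0 ->
  (forall u, 0 <= u <= v -> Rabs (f (e * u)) <= db u) ->
  Rabs (F (e * v)) <= b v.
Proof.
  intros F f b db e v He Hv F0 DF Db B0 L.
  assert (K : forall c, c = 1 \/ c = -1 -> c * F (e * v) <= b v).
  { intros c Hc.
    assert (D : forall s, is_derive (fun s => c * F (0 + e * s) + -1 * b s) s
                            (c * (e * f (0 + e * s)) + -1 * db s)).
    { intros s; apply is_derive_lincomb; [|apply Db].
      apply (is_derive_affine F 0 e s), DF. }
    generalize (increment_le (fun s => c * F (0 + e * s) + -1 * b s)
      (fun s => c * (e * f (0 + e * s)) + -1 * db s) 0 v 0 Hv (fun s _ => D s)).
    rewrite Rmult_0_r, Rplus_0_l, Rplus_0_l, F0; intros I.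
    cut (c * (e * 0) + -1 * b 0 <= 0); [|lra]; intros _.
    cut (c * F (e * v) + -1 * b v - (c * 0 + -1 * b 0) <= 0 * (v - 0)); [lra|].
    apply I; intros s Hs; rewrite Rplus_0_l.
    generalize (L s Hs); intros Ls; apply Rabs_le_between in Ls.
    destruct He as [-> | ->], Hc as [-> | ->]; lra. }
  generalize (K 1 (or_introl eq_refl)) (K (-1) (or_intror eq_refl)); intros K1 K2.
  apply Rabs_le; lra.
Qed.

Lemma exp_monotone : forall a b, a <= b -> exp a <= exp b.
Proof.
  intros a b [L | <-]; [left; apply exp_increasing, L | apply Rle_refl].
Qed.

Lemma sign_decomposition : forall s, exists e, (e = 1 \/ e = -1) /\ s = e * Rabs s.
Proof.
  intros s; destruct (Rle_or_lt 0 s) as [P | P].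
  - exists 1; split; [left; reflexivity | rewrite Rabs_pos_eq by exact P; ring].
  - exists (-1); split; [right; reflexivity | rewrite Rabs_left by exact P; ring].
Qed.

Lemma abs_sign_mult : forall e u, e = 1 \/ e = -1 -> 0 <= u -> Rabs (e * u) = u.
Proof.
  intros e u [-> | ->] Hu.
  - rewrite Rmult_1_l, Rabs_pos_eq; trivial.
  - replace (-1 * u) with (- u) by ring; rewrite Rabs_Ropp, Rabs_pos_eq; trivial.
Qed.

Lemma primitive_derive : forall f : R -> R, (forall s, continuous f s) ->
  forall s, is_derive (fun s => RInt f 0 s) s (f s).
Proof.
  intros f Cf s; apply (is_derive_RInt f _ 0); [|apply Cf].
  apply filter_forall; intros y; apply (RInt_correct f 0 y).
  apply ex_RInt_continuous; intros z _; apply Cf.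
Qed.

Lemma primitive_exp_bound : forall f c a s,
  (forall s, continuous f s) -> 0 < a -> 0 <= c ->
  (forall u, Rabs u <= Rabs s -> Rabs (f u) <= c * exp (a * Rabs u)) ->
  Rabs (RInt f 0 s) <= c / a * exp (a * Rabs s).
Proof.
  intros f c a s Cf Pa Pc L.
  destruct (sign_decomposition s) as [e [He Es]].
  rewrite Es at 1.
  apply (abs_le_of_derive_bound (fun s => RInt f 0 s) f
           (fun v => c / a * exp (a * v)) (fun v => c * exp (a * v)) e);
    [exact He | apply Rabs_pos | apply (RInt_point 0 f)
    | apply primitive_derive, Cf | | |].
  - intros v; auto_derive; trivial; field; lra.
  - apply Rmult_le_pos; [apply Rdiv_le_0_compat; lra | left; apply exp_pos].
  - intros u Hu.
    rewrite <- (abs_sign_mult e u He (proj1 Hu)) at 2.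
    apply L; rewrite (abs_sign_mult e u He (proj1 Hu)); apply Hu.
Qed.

Lemma primitive_linear_bound : forall f c s, (forall s, continuous f s) -> 0 <= c ->
  (forall u, Rabs u <= Rabs s -> Rabs (f u) <= c) ->
  Rabs (RInt f 0 s) <= c * Rabs s.
Proof.
  intros f c s Cf Pc L.
  destruct (sign_decomposition s) as [e [He Es]].
  rewrite Es at 1.
  apply (abs_le_of_derive_bound (fun s => RInt f 0 s) f
           (fun v => c * v) (fun _ => c) e);
    [exact He | apply Rabs_pos | apply (RInt_point 0 f)
    | apply primitive_derive, Cf | | |].
  - intros v; auto_derive; trivial; ring.
  - lra.
  - intros u Hu; apply L; rewrite (abs_sign_mult e u He (proj1 Hu)); apply Hu.
Qed.

(** [G y s] depends on the values of [y] between [- |s|] and [|s|] only, in a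
    Lipschitz way, locally uniformly in [s].  This is what the right-hand side of
    an ordinary differential equation looks like once some of the unknowns have
    been replaced by integrals of the remaining ones. *)
Definition causally_lipschitz (G : (R -> R) -> R -> R) : Prop :=
  forall S, 0 < S -> exists L, 0 < L /\
    forall y z, (forall s, continuous y s) -> (forall s, continuous z s) ->
    forall s m, Rabs s <= S ->
      (forall u, Rabs u <= Rabs s -> Rabs (y u - z u) <= m) ->
      Rabs (G y s - G z s) <= L * m.

Fixpoint picard (G : (R -> R) -> R -> R) (y0 : R) (n : nat) (s : R) : R :=
  match n with
  | O => y0
  | S m => y0 + RInt (G (picard G y0 m)) 0 s
  end.

Lemma picard_continuous : forall G y0,
  (forall y, (forall s, continuous y s) -> forall s, continuous (G y) s) ->
  forall n s, continuous (picard G y0 n) s.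
Proof.
  intros G y0 CG; induction n as [|n IH]; intros s; [apply continuous_const|].
  apply (continuous_plus (V := R_NormedModule) (fun _ => y0)
           (fun s => RInt (G (picard G y0 n)) 0 s)); [apply continuous_const|].
  apply (ex_derive_continuous (V := R_NormedModule)).
  eexists; apply primitive_derive, CG, IH.
Qed.

Lemma RInt_minus_continuous : forall (f g : R -> R) s,
  (forall u, continuous f u) -> (forall u, continuous g u) ->
  RInt f 0 s - RInt g 0 s = RInt (fun u => f u - g u) 0 s.
Proof.
  intros f g s Cf Cg; symmetry; apply (RInt_minus (V := R_CompleteNormedModule));
    apply ex_RInt_continuous; intros z _; auto.
Qed.

(** In the norm weighted by [exp (- 2 * L * |s|)] one integration gains the factor
    [1 / (2 * L)], so that each step halves the distance. *)
Lemma picard_step : forall G y0,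
  (forall y, (forall s, continuous y s) -> forall s, continuous (G y) s) ->
  causally_lipschitz G ->
  forall S, 0 < S -> exists M, 0 <= M /\ forall n s, Rabs s <= S ->
    Rabs (picard G y0 (Datatypes.S n) s - picard G y0 n s) <= M * (1 / 2) ^ n.
Proof.
  intros G y0 CG LG S PS.
  assert (CP := picard_continuous G y0 CG).
  destruct (LG S PS) as [L [PL HL]].
  destruct (bounded_continuity (V := R_NormedModule) (picard G y0 1) (- S) S
              (fun x _ => CP 1%nat x)) as [M HM].
  set (M0 := M + Rabs y0).
  assert (B0 : forall s, Rabs s <= S -> Rabs (picard G y0 1 s - picard G y0 0 s) <= M0).
  { intros s Hs; apply Rle_trans with (1 := Rabs_triang _ _).
    rewrite Rabs_Ropp; simpl picard at 2; unfold M0; apply Rplus_le_compat_r.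
    left; apply (HM s); apply Rabs_le_between, Hs. }
  assert (PM0 : 0 <= M0).
  { apply Rle_trans with (2 := B0 0 ltac:(rewrite Rabs_R0; lra)); apply Rabs_pos. }
  assert (Step : forall n s, Rabs s <= S ->
    Rabs (picard G y0 (Datatypes.S n) s - picard G y0 n s)
    <= M0 * (1 / 2) ^ n * exp (2 * L * Rabs s)).
  { induction n as [|n IH]; intros s Hs.
    - apply Rle_trans with (1 := B0 s Hs).
      rewrite pow_O, Rmult_1_r, <- (Rmult_1_r M0) at 1.
      apply Rmult_le_compat_l; [exact PM0|].
      rewrite <- exp_0; apply exp_monotone; generalize (Rabs_pos s); nra.
    - change (Rabs (y0 + RInt (G (picard G y0 (Datatypes.S n))) 0 s
                    - (y0 + RInt (G (picard G y0 n)) 0 s))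
              <= M0 * (1 / 2) ^ (Datatypes.S n) * exp (2 * L * Rabs s)).
      replace (y0 + RInt (G (picard G y0 (Datatypes.S n))) 0 s
               - (y0 + RInt (G (picard G y0 n)) 0 s))
        with (RInt (G (picard G y0 (Datatypes.S n))) 0 s - RInt (G (picard G y0 n)) 0 s)
        by ring.
      rewrite RInt_minus_continuous by (apply CG, CP).
      replace (M0 * (1 / 2) ^ (Datatypes.S n))
        with (L * (M0 * (1 / 2) ^ n) / (2 * L)) by (simpl; field; lra).
      apply primitive_exp_bound; [|lra| |].
      + intros u; apply continuous_minus_R; apply CG, CP.
      + apply Rmult_le_pos; [lra|]; apply Rmult_le_pos; [exact PM0|].
        apply pow_le; lra.
      + intros u Hu; rewrite Rmult_assoc.
        apply HL; [apply CP | apply CP | lra |].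
        intros v Hv; apply Rle_trans with (1 := IH v ltac:(lra)).
        apply Rmult_le_compat_l.
        * apply Rmult_le_pos; [exact PM0 | apply pow_le; lra].
        * apply exp_monotone, Rmult_le_compat_l; lra. }
  exists (M0 * exp (2 * L * S)); split.
  { apply Rmult_le_pos; [exact PM0 | left; apply exp_pos]. }
  intros n s Hs; apply Rle_trans with (1 := Step n s Hs).
  replace (M0 * exp (2 * L * S) * (1 / 2) ^ n)
    with (M0 * (1 / 2) ^ n * exp (2 * L * S)) by ring.
  apply Rmult_le_compat_l.
  - apply Rmult_le_pos; [exact PM0 | apply pow_le; lra].
  - apply exp_monotone, Rmult_le_compat_l; lra.
Qed.

Lemma geometric_tail : forall (u : nat -> R) M, 0 <= M ->
  (forall n, Rabs (u (S n) - u n) <= M * (1 / 2) ^ n) ->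
  exists l, is_lim_seq u l /\ forall n, Rabs (l - u n) <= 2 * M * (1 / 2) ^ n.
Proof.
  intros u M PM H.
  assert (T : forall n k, Rabs (u (n + k)%nat - u n)
                          <= 2 * M * (1 / 2) ^ n * (1 - (1 / 2) ^ k)).
  { intros n; induction k as [|k IH].
    - rewrite Nat.add_0_r, Rminus_diag; rewrite Rabs_R0; simpl; lra.
    - rewrite Nat.add_succ_r.
      replace (u (S (n + k)) - u n) with
        ((u (S (n + k)) - u (n + k)%nat) + (u (n + k)%nat - u n)) by ring.
      apply Rle_trans with (1 := Rabs_triang _ _).
      generalize (H (n + k)%nat); rewrite pow_add; simpl ((1 / 2) ^ S k); lra. }
  assert (T' : forall n m, (n <= m)%nat -> Rabs (u m - u n) <= 2 * M * (1 / 2) ^ n).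
  { intros n m Hnm; replace m with (n + (m - n))%nat by lia.
    apply Rle_trans with (1 := T n (m - n)%nat).
    rewrite <- (Rmult_1_r (2 * M * (1 / 2) ^ n)) at 2.
    apply Rmult_le_compat_l.
    - apply Rmult_le_pos; [lra | apply pow_le; lra].
    - generalize (pow_le (1 / 2) (m - n)); lra. }
  assert (Z : is_lim_seq (fun n => 2 * M * (1 / 2) ^ n) 0).
  { replace (Finite 0) with (Rbar_mult (2 * M) 0) by (simpl; f_equal; ring).
    apply is_lim_seq_scal_l, is_lim_seq_geom; rewrite Rabs_pos_eq; lra. }
  assert (E : ex_finite_lim_seq u).
  { apply ex_lim_seq_cauchy_corr; intros eps.
    apply is_lim_seq_spec in Z.
    destruct (Z (mkposreal _ (is_pos_div_2 eps))) as [N HN].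
    exists N; intros n m Hn Hm.
    generalize (HN N (le_n N)) (T' N n Hn) (T' N m Hm); simpl.
    rewrite Rminus_0_r; intros A1 A2 A3; apply Rabs_lt_between in A1.
    replace (u n - u m) with ((u n - u N) + - (u m - u N)) by ring.
    apply Rle_lt_trans with (1 := Rabs_triang _ _); rewrite Rabs_Ropp; lra. }
  destruct E as [l Hl]; exists l; split; [exact Hl|]; intros n.
  apply (is_lim_seq_le_loc (fun m => Rabs (u m - u n)) (fun _ => 2 * M * (1 / 2) ^ n)
           (Rabs (l - u n)) (2 * M * (1 / 2) ^ n)).
  - exists n; intros m Hm; apply T', Hm.
  - apply (is_lim_seq_abs _ (l - u n)).
    apply is_lim_seq_minus'; [exact Hl | apply is_lim_seq_const].
  - apply is_lim_seq_const.
Qed.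

Lemma geometric_small : forall K eps, 0 <= K -> 0 < eps ->
  exists n, K * (1 / 2) ^ n < eps.
Proof.
  intros K eps PK Pe.
  assert (Z : is_lim_seq (fun n => K * (1 / 2) ^ n) 0).
  { replace (Finite 0) with (Rbar_mult K 0) by (simpl; f_equal; ring).
    apply is_lim_seq_scal_l, is_lim_seq_geom; rewrite Rabs_pos_eq; lra. }
  apply is_lim_seq_spec in Z; destruct (Z (mkposreal eps Pe)) as [N HN].
  exists N; generalize (HN N (le_n N)); simpl; rewrite Rminus_0_r.
  apply Rle_lt_trans, Rle_abs.
Qed.

Lemma continuous_of_local_uniform_limit : forall (f : nat -> R -> R) (g : R -> R),
  (forall n s, continuous (f n) s) ->
  (forall S, 0 < S -> exists K, 0 <= K /\
     forall n s, Rabs s <= S -> Rabs (g s - f n s) <= K * (1 / 2) ^ n) ->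
  forall s, continuous g s.
Proof.
  intros f g Cf H s.
  destruct (H (Rabs s + 1)) as [K [PK HK]]; [generalize (Rabs_pos s); lra|].
  apply filterlim_locally; intros eps.
  destruct (geometric_small K (eps / 3) PK) as [n Hn];
    [generalize (cond_pos eps); lra|].
  assert (Pe : 0 < eps / 3) by (generalize (cond_pos eps); lra).
  generalize (proj1 (filterlim_locally (f n) (f n s)) (Cf n s) (mkposreal _ Pe)).
  intros [d Hd].
  exists (mkposreal (Rmin d 1) (Rmin_stable_in_posreal d (mkposreal 1 Rlt_0_1))).
  intros u Hu; change (Rabs (u - s) < Rmin d 1) in Hu.
  assert (U1 : Rabs (u - s) < d) by (apply Rlt_le_trans with (1 := Hu), Rmin_l).
  assert (U2 : Rabs (u - s) < 1) by (apply Rlt_le_trans with (1 := Hu), Rmin_r).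
  assert (U3 : Rabs u <= Rabs s + 1).
  { replace u with ((u - s) + s) by ring.
    apply Rle_trans with (1 := Rabs_triang _ _); lra. }
  generalize (Hd u U1) (HK n u U3) (HK n s ltac:(lra)).
  change (ball (f n s) {| pos := eps / 3; cond_pos := Pe |} (f n u))
    with (Rabs (f n u - f n s) < eps / 3).
  change (ball (g s) eps (g u)) with (Rabs (g u - g s) < eps).
  intros A1 A2 A3.
  replace (g u - g s) with ((g u - f n u) + ((f n u - f n s) + - (g s - f n s))) by ring.
  apply Rle_lt_trans with (1 := Rabs_triang _ _).
  generalize (Rabs_triang (f n u - f n s) (- (g s - f n s))); rewrite Rabs_Ropp; lra.
Qed.

(** The Picard iterates converge locally uniformly, and both sides of the integral
    equation pass to the limit. *)
Lemma causal_equation_solvable : forall (G : (R -> R) -> R -> R) y0,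
  (forall y, (forall s, continuous y s) -> forall s, continuous (G y) s) ->
  causally_lipschitz G ->
  exists y, y 0 = y0 /\ forall s, is_derive y s (G y s).
Proof.
  intros G y0 CG LG.
  assert (CP := picard_continuous G y0 CG).
  set (y := fun s => real (Lim_seq (fun n => picard G y0 n s))).
  assert (HK : forall S, 0 < S -> exists K, 0 <= K /\ forall n s, Rabs s <= S ->
            Rabs (y s - picard G y0 n s) <= K * (1 / 2) ^ n).
  { intros S PS; destruct (picard_step G y0 CG LG S PS) as [M [PM HM]].
    exists (2 * M); split; [lra|]; intros n s Hs.
    destruct (geometric_tail _ M PM (fun n => HM n s Hs)) as [l [Hl Tl]].
    unfold y; rewrite (is_lim_seq_unique _ _ Hl); apply Tl. }
  assert (Cy : forall s, continuous y s)
    by exact (continuous_of_local_uniform_limit _ y CP HK).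
  assert (Ey : forall s, y s = y0 + RInt (G y) 0 s).
  { intros s; apply Rminus_diag_uniq, Rabs_eq_0.
    apply Rle_antisym; [|apply Rabs_pos].
    apply le_epsilon; intros eps Pe; rewrite Rplus_0_l.
    set (S := Rabs s + 1).
    assert (PS : 0 < S) by (unfold S; generalize (Rabs_pos s); lra).
    destruct (HK S PS) as [K [PK Kn]].
    destruct (LG S PS) as [L [PL HL]].
    destruct (geometric_small (K + L * K * S) eps) as [n Hn]; [|exact Pe|].
    { apply Rplus_le_le_0_compat; [exact PK|].
      repeat apply Rmult_le_pos; lra. }
    assert (Hs : Rabs s <= S) by (unfold S; lra).
    replace (y s - (y0 + RInt (G y) 0 s))
      with ((y s - picard G y0 (Datatypes.S n) s)
            + (RInt (G (picard G y0 n)) 0 s - RInt (G y) 0 s)) by (simpl; ring).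
    rewrite RInt_minus_continuous by (apply CG; auto).
    apply Rle_trans with (1 := Rabs_triang _ _).
    assert (Pn : 0 <= (1 / 2) ^ n) by (apply pow_le; lra).
    assert (B1 := Kn (Datatypes.S n) s Hs); simpl ((1 / 2) ^ _) in B1.
    assert (B2 : Rabs (RInt (fun u => G (picard G y0 n) u - G y u) 0 s)
                 <= L * (K * (1 / 2) ^ n) * Rabs s).
    { apply primitive_linear_bound.
      - intros u; apply continuous_minus_R; apply CG; auto.
      - apply Rmult_le_pos; [lra|]; apply Rmult_le_pos; assumption.
      - intros u Hu; apply HL; [apply CP | exact Cy | lra|].
        intros v Hv; rewrite Rabs_minus_sym; apply Kn; lra. }
    assert (B3 : L * (K * (1 / 2) ^ n) * Rabs s <= L * (K * (1 / 2) ^ n) * S).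
    { apply Rmult_le_compat_l; [|exact Hs].
      apply Rmult_le_pos; [lra|]; apply Rmult_le_pos; assumption. }
    assert (0 <= K * (1 / 2) ^ n) by (apply Rmult_le_pos; assumption).
    assert (B4 : K * (1 / 2 * (1 / 2) ^ n) <= K * (1 / 2) ^ n) by lra.
    replace ((K + L * K * S) * (1 / 2) ^ n)
      with (K * (1 / 2) ^ n + L * (K * (1 / 2) ^ n) * S) in Hn by ring.
    lra. }
  exists y; split.
  - rewrite Ey; rewrite (RInt_point 0 (G y)); unfold zero; simpl; ring.
  - intros s; apply (is_derive_ext (fun s => y0 + RInt (G y) 0 s));
      [intros u; symmetry; apply Ey|].
    apply (is_derive_eq _ _ _ _ (is_derive_plus _ _ _ _ _
      (is_derive_const y0 s) (primitive_derive (G y) (CG y Cy) s))).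
    unfold plus, zero; simpl; ring.
Qed.

(** * Existence of solutions *)

(** [u] and [v] are meant as the values of one function at two points at distance
    [d].  Keeping the bound and the Lipschitz estimate together makes the notion
    stable under products and inverses. *)
Definition lipschitz_pair (d k u v : R) : Prop :=
  Rabs u <= k /\ Rabs v <= k /\ Rabs (u - v) <= k * d.

Lemma lipschitz_pair_bound_nonneg : forall d k u v, lipschitz_pair d k u v -> 0 <= k.
Proof. intros d k u v [H _]; generalize (Rabs_pos u); lra. Qed.

Lemma lipschitz_pair_const : forall d c, 0 <= d -> lipschitz_pair d (Rabs c) c c.
Proof.
  intros d c Hd; repeat split; try apply Rle_refl.
  rewrite Rminus_diag, Rabs_R0; apply Rmult_le_pos; [apply Rabs_pos | exact Hd].
Qed.

Lemma lipschitz_pair_plus : forall d k l u v u' v',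
  lipschitz_pair d k u v -> lipschitz_pair d l u' v' ->
  lipschitz_pair d (k + l) (u + u') (v + v').
Proof.
  intros d k l u v u' v' [A1 [A2 A3]] [B1 [B2 B3]]; repeat split.
  - apply Rle_trans with (1 := Rabs_triang _ _); lra.
  - apply Rle_trans with (1 := Rabs_triang _ _); lra.
  - replace (u + u' - (v + v')) with ((u - v) + (u' - v')) by ring.
    apply Rle_trans with (1 := Rabs_triang _ _); lra.
Qed.

Lemma lipschitz_pair_opp : forall d k u v,
  lipschitz_pair d k u v -> lipschitz_pair d k (- u) (- v).
Proof.
  intros d k u v [A1 [A2 A3]]; repeat split; try (rewrite Rabs_Ropp; assumption).
  replace (- u - - v) with (- (u - v)) by ring; rewrite Rabs_Ropp; exact A3.
Qed.

Lemma lipschitz_pair_mult : forall d k l u v u' v', 0 <= d ->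
  lipschitz_pair d k u v -> lipschitz_pair d l u' v' ->
  lipschitz_pair d (2 * (k * l)) (u * u') (v * v').
Proof.
  intros d k l u v u' v' Hd HA HB.
  assert (Pk := lipschitz_pair_bound_nonneg _ _ _ _ HA).
  assert (Pl := lipschitz_pair_bound_nonneg _ _ _ _ HB).
  assert (Pkl : 0 <= k * l) by (apply Rmult_le_pos; assumption).
  destruct HA as [A1 [A2 A3]]; destruct HB as [B1 [B2 B3]].
  assert (P1 : forall x y, Rabs x <= k -> Rabs y <= l -> Rabs (x * y) <= k * l).
  { intros x y Hx Hy; rewrite Rabs_mult; apply Rmult_le_compat;
      try apply Rabs_pos; assumption. }
  repeat split.
  - generalize (P1 u u' A1 B1); lra.
  - generalize (P1 v v' A2 B2); lra.
  - replace (u * u' - v * v') with (u * (u' - v') + (u - v) * v') by ring.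
    apply Rle_trans with (1 := Rabs_triang _ _); rewrite !Rabs_mult.
    assert (Rabs u * Rabs (u' - v') <= k * (l * d))
      by (apply Rmult_le_compat; try apply Rabs_pos; assumption).
    assert (Rabs (u - v) * Rabs v' <= k * d * l)
      by (apply Rmult_le_compat; try apply Rabs_pos; assumption).
    lra.
Qed.

Lemma lipschitz_pair_inv : forall d k m u v, 0 <= d -> 0 < m -> m <= u -> m <= v ->
  lipschitz_pair d k u v -> lipschitz_pair d (/ m + k * (/ m * / m)) (/ u) (/ v).
Proof.
  intros d k m u v Hd Pm Hu Hv HA.
  assert (Pk := lipschitz_pair_bound_nonneg _ _ _ _ HA); destruct HA as [_ [_ A3]].
  assert (Im := Rinv_0_lt_compat m Pm).
  assert (Pz : 0 <= k * (/ m * / m)) by (apply Rmult_le_pos; nra).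
  assert (B : forall x, m <= x -> 0 < / x <= / m).
  { intros x Hx; split; [apply Rinv_0_lt_compat; lra | apply Rinv_le_contravar; lra]. }
  destruct (B u Hu) as [U0 U1]; destruct (B v Hv) as [V0 V1].
  repeat split.
  - rewrite Rabs_pos_eq; lra.
  - rewrite Rabs_pos_eq; lra.
  - replace (/ u - / v) with (- (u - v) * (/ u * / v)) by (field; lra).
    rewrite Rabs_mult, Rabs_Ropp, (Rabs_pos_eq (/ u * / v)) by nra.
    apply Rle_trans with (k * d * (/ m * / m)).
    + apply Rmult_le_compat; [apply Rabs_pos | nra | exact A3|].
      apply Rmult_le_compat; lra.
    + assert (0 <= / m * d) by (apply Rmult_le_pos; lra); lra.
Qed.

Definition frame_bend (h x y a b : R) : R :=
  bend h (x * a + y * b) (y * a - x * b).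

Lemma frame_bend_lipschitz : forall h M, 0 < h -> 1 <= M -> exists L, 0 < L /\
  forall d x y a b x' y' a' b', 0 <= d ->
    lipschitz_pair d M x x' -> lipschitz_pair d M y y' ->
    lipschitz_pair d M a a' -> lipschitz_pair d M b b' ->
    lipschitz_pair d L (frame_bend h x y a b) (frame_bend h x' y' a' b').
Proof.
  intros h M Hh HM.
  set (k := 2 * (M * M) + 2 * (M * M)).
  set (g := Rabs (h ^ 2)).
  assert (Pk : 0 < k) by (unfold k; nra).
  assert (Pg : 0 <= g) by apply Rabs_pos.
  assert (Ph : 0 < h ^ 2) by nra.
  assert (Ih := Rinv_0_lt_compat _ Ph).
  exists (2 * ((2 * (k * (2 * (k * k) + g)) + k)
               * (/ h ^ 2 + (2 * (k * k) + 2 * (k * k) + g) * (/ h ^ 2 * / h ^ 2)))).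
  split.
  - assert (0 < k * k) by nra; assert (0 < / h ^ 2 * / h ^ 2) by nra.
    assert (0 <= k * (2 * (k * k) + g)) by (apply Rmult_le_pos; lra).
    assert (0 <= (2 * (k * k) + 2 * (k * k) + g) * (/ h ^ 2 * / h ^ 2))
      by (apply Rmult_le_pos; lra).
    apply Rmult_lt_0_compat; [lra|]; apply Rmult_lt_0_compat; lra.
  - intros d x y a b x' y' a' b' Hd Hx Hy Ha Hb.
    assert (Ht : lipschitz_pair d k (x * a + y * b) (x' * a' + y' * b'))
      by (apply lipschitz_pair_plus; apply lipschitz_pair_mult; assumption).
    assert (Hn : lipschitz_pair d k (y * a - x * b) (y' * a' - x' * b'))
      by (apply lipschitz_pair_plus; [|apply lipschitz_pair_opp];
          apply lipschitz_pair_mult; assumption).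
    assert (Hh2 : lipschitz_pair d g (h ^ 2) (h ^ 2)) by (apply lipschitz_pair_const, Hd).
    unfold frame_bend, bend.
    set (t := x * a + y * b) in *; set (t' := x' * a' + y' * b') in *.
    set (n := y * a - x * b) in *; set (n' := y' * a' - x' * b') in *.
    replace (t ^ 2) with (t * t) by ring; replace (t' ^ 2) with (t' * t') by ring.
    replace (n ^ 2) with (n * n) by ring; replace (n' ^ 2) with (n' * n') by ring.
    assert (T2 := lipschitz_pair_mult _ _ _ _ _ _ _ Hd Ht Ht).
    assert (N2 := lipschitz_pair_mult _ _ _ _ _ _ _ Hd Hn Hn).
    apply (lipschitz_pair_mult _ _ _ _ _ _ _ Hd).
    + exact (lipschitz_pair_plus _ _ _ _ _ _ _
               (lipschitz_pair_mult _ _ _ _ _ _ _ Hd Ht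
                  (lipschitz_pair_plus _ _ _ _ _ _ _ T2 Hh2))
               (lipschitz_pair_opp _ _ _ _ Hn)).
    + apply lipschitz_pair_inv; [exact Hd | exact Ph | | |].
      * generalize (Rle_0_sqr t) (Rle_0_sqr n); unfold Rsqr; lra.
      * generalize (Rle_0_sqr t') (Rle_0_sqr n'); unfold Rsqr; lra.
      * exact (lipschitz_pair_plus _ _ _ _ _ _ _
                 (lipschitz_pair_plus _ _ _ _ _ _ _ T2 N2) Hh2).
Qed.

Lemma along_across_frame_bend : forall h X T s,
  bend h (along X T s) (across X T s)
  = frame_bend h (Re (X s)) (Im (X s)) (Re (T s)) (Im (T s)).
Proof. intros; unfold frame_bend; rewrite along_expand, across_expand; reflexivity. Qed.

Lemma abs_increment_le : forall f df : R -> R,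
  (forall s, is_derive f s (df s)) -> (forall s, Rabs (df s) <= 1) ->
  forall a b, Rabs (f a - f b) <= Rabs (a - b).
Proof.
  intros f df D B a b; destruct (MVT_gen f b a df) as [z [_ E]].
  - intros s _; apply D.
  - intros s _; apply continuity_pt_filterlim.
    apply (ex_derive_continuous f s); eexists; apply D.
  - rewrite E, Rabs_mult; rewrite <- (Rmult_1_l (Rabs (a - b))) at 2.
    apply Rmult_le_compat_r; [apply Rabs_pos | apply B].
Qed.

Lemma cos_nonexpansive : forall a b, Rabs (cos a - cos b) <= Rabs (a - b).
Proof.
  apply (abs_increment_le cos (fun s => - sin s)); [apply is_derive_cos|].
  intros s; apply Rabs_le; generalize (SIN_bound s); lra.
Qed.

Lemma sin_nonexpansive : forall a b, Rabs (sin a - sin b) <= Rabs (a - b).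
Proof.
  apply (abs_increment_le sin cos); [apply is_derive_sin|].
  intros s; apply Rabs_le; generalize (COS_bound s); lra.
Qed.

Lemma unit_coordinates : forall a b, a ^ 2 + b ^ 2 = 1 -> Rabs a <= 1 /\ Rabs b <= 1.
Proof. intros a b U; split; apply Rabs_le; split; nra. Qed.

Lemma primitive_unit_lipschitz_pair : forall f g c s m, 0 <= m ->
  (forall u, continuous f u) -> (forall u, continuous g u) ->
  (forall u, Rabs (f u) <= 1) -> (forall u, Rabs (g u) <= 1) ->
  (forall u, Rabs u <= Rabs s -> Rabs (f u - g u) <= m) ->
  lipschitz_pair m (Rabs c + Rabs s) (c + RInt f 0 s) (c + RInt g 0 s).
Proof.
  intros f g c s m Pm Cf Cg Bf Bg H.
  assert (B : forall f, (forall u, continuous f u) -> (forall u, Rabs (f u) <= 1) ->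
            Rabs (c + RInt f 0 s) <= Rabs c + Rabs s).
  { intros w Cw Bw; apply Rle_trans with (1 := Rabs_triang _ _).
    apply Rplus_le_compat_l; rewrite <- (Rmult_1_l (Rabs s)).
    apply primitive_linear_bound; [exact Cw | lra | intros u _; apply Bw]. }
  repeat split; [apply B; assumption | apply B; assumption|].
  replace (c + RInt f 0 s - (c + RInt g 0 s)) with (RInt f 0 s - RInt g 0 s) by ring.
  rewrite RInt_minus_continuous by assumption.
  apply Rle_trans with (m * Rabs s).
  - apply primitive_linear_bound; [|exact Pm|exact H].
    intros u; apply continuous_minus_R; auto.
  - assert (0 <= Rabs c * m) by (apply Rmult_le_pos; [apply Rabs_pos | exact Pm]); lra.
Qed.

Lemma lipschitz_pair_weaken : forall d k k' u v, 0 <= d -> k <= k' ->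
  lipschitz_pair d k u v -> lipschitz_pair d k' u v.
Proof.
  intros d k k' u v Hd L [A1 [A2 A3]]; repeat split; try lra.
  apply Rle_trans with (1 := A3), Rmult_le_compat_r; assumption.
Qed.

(** The only unknown is the tangent angle [th]: the position [(px, py)] is a
    function of the past of [th] and, the speed being one, it stays at distance at
    most [|s|] from [z].  There the curvature is a Lipschitz function of the
    position and the tangent. *)
Lemma profile_exists : forall h (z : C), 0 < h -> exists X T,
  profile_solution h X T /\ X 0 = z /\ T 0 = RtoC 1.
Proof.
  intros h z Hh.
  set (px := fun (th : R -> R) s => Re z + RInt (fun u => cos (th u)) 0 s).
  set (py := fun (th : R -> R) s => Im z + RInt (fun u => sin (th u)) 0 s).
  set (G := fun (th : R -> R) s =>
              frame_bend h (px th s) (py th s) (cos (th s)) (sin (th s))).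
  assert (Cc : forall th : R -> R, (forall s, continuous th s) ->
            forall s, continuous (fun u => cos (th u)) s).
  { intros th Ct s; apply continuous_cos_comp, Ct. }
  assert (Cs : forall th : R -> R, (forall s, continuous th s) ->
            forall s, continuous (fun u => sin (th u)) s).
  { intros th Ct s; apply continuous_sin_comp, Ct. }
  assert (Dx : forall th : R -> R, (forall s, continuous th s) ->
            forall s, is_derive (px th) s (cos (th s))).
  { intros th Ct s; apply (is_derive_eq _ _ _ _ (is_derive_plus _ _ _ _ _
      (is_derive_const (Re z) s) (primitive_derive _ (Cc th Ct) s))).
    unfold plus, zero; simpl; ring. }
  assert (Dy : forall th : R -> R, (forall s, continuous th s) ->
            forall s, is_derive (py th) s (sin (th s))).
  { intros th Ct s; apply (is_derive_eq _ _ _ _ (is_derive_plus _ _ _ _ _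
      (is_derive_const (Im z) s) (primitive_derive _ (Cs th Ct) s))).
    unfold plus, zero; simpl; ring. }
  destruct (causal_equation_solvable G 0) as [th [T0 DT]].
  - intros th Ct s.
    assert (Cx : continuous (px th) s)
      by (apply (ex_derive_continuous (V := R_NormedModule)); eexists; apply Dx, Ct).
    assert (Cy : continuous (py th) s)
      by (apply (ex_derive_continuous (V := R_NormedModule)); eexists; apply Dy, Ct).
    apply (bend_continuous h
      (fun s => px th s * cos (th s) + py th s * sin (th s))
      (fun s => py th s * cos (th s) - px th s * sin (th s))); [exact Hh| |].
    + apply continuous_plus_R; apply continuous_mult_R; auto.
    + apply continuous_minus_R; apply continuous_mult_R; auto.
  - intros S PS.
    set (M := Rabs (Re z) + Rabs (Im z) + S + 1).
    assert (P1 := Rabs_pos (Re z)); assert (P2 := Rabs_pos (Im z)).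
    destruct (frame_bend_lipschitz h M Hh) as [L [PL HL]]; [unfold M; lra|].
    exists L; split; [exact PL|]; intros th th' Ct Ct' s m Hs Hm.
    assert (Pm : 0 <= m).
    { apply Rle_trans with (1 := Rabs_pos (th 0 - th' 0)), Hm.
      rewrite Rabs_R0; apply Rabs_pos. }
    apply HL; [exact Pm | | | |].
    + apply (lipschitz_pair_weaken m (Rabs (Re z) + Rabs s)); [exact Pm | unfold M; lra|].
      apply primitive_unit_lipschitz_pair; auto.
      * intros u; apply Rabs_le; generalize (COS_bound (th u)); lra.
      * intros u; apply Rabs_le; generalize (COS_bound (th' u)); lra.
      * intros u Hu; apply Rle_trans with (1 := cos_nonexpansive _ _), Hm, Hu.
    + apply (lipschitz_pair_weaken m (Rabs (Im z) + Rabs s)); [exact Pm | unfold M; lra|].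
      apply primitive_unit_lipschitz_pair; auto.
      * intros u; apply Rabs_le; generalize (SIN_bound (th u)); lra.
      * intros u; apply Rabs_le; generalize (SIN_bound (th' u)); lra.
      * intros u Hu; apply Rle_trans with (1 := sin_nonexpansive _ _), Hm, Hu.
    + apply (lipschitz_pair_weaken m 1); [exact Pm | unfold M; lra|]; repeat split.
      * apply Rabs_le; generalize (COS_bound (th s)); lra.
      * apply Rabs_le; generalize (COS_bound (th' s)); lra.
      * rewrite Rmult_1_l; apply Rle_trans with (1 := cos_nonexpansive _ _), Hm; lra.
    + apply (lipschitz_pair_weaken m 1); [exact Pm | unfold M; lra|]; repeat split.
      * apply Rabs_le; generalize (SIN_bound (th s)); lra.
      * apply Rabs_le; generalize (SIN_bound (th' s)); lra.
      * rewrite Rmult_1_l; apply Rle_trans with (1 := sin_nonexpansive _ _), Hm; lra.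
  - assert (Ct : forall s, continuous th s)
      by (intros s; apply (ex_derive_continuous (V := R_NormedModule)); eexists; apply DT).
    exists (fun s => (px th s, py th s)), (fun s => expi (th s)).
    assert (EG : forall s, bend h
        (along (fun s => (px th s, py th s)) (fun s => expi (th s)) s)
        (across (fun s => (px th s, py th s)) (fun s => expi (th s)) s) = G th s)
      by (intros s; apply along_across_frame_bend).
    split; [split|split].
    + exact (Dx th Ct).
    + exact (Dy th Ct).
    + intros s; rewrite EG.
      apply (is_derive_eq _ _ _ _
        (is_derive_comp cos th s _ _ (is_derive_cos _) (DT s))).
      unfold scal; simpl; unfold mult; simpl; ring.
    + intros s; rewrite EG.
      apply (is_derive_eq _ _ _ _
        (is_derive_comp sin th s _ _ (is_derive_sin _) (DT s))).
      unfold scal; simpl; unfold mult; simpl; ring.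
    + intros s; simpl; generalize (sin2_cos2 (th s)); unfold Rsqr; lra.
    + rewrite (C_split z); unfold px, py.
      rewrite (RInt_point 0 (fun u => cos (th u))), (RInt_point 0 (fun u => sin (th u))).
      unfold zero; simpl; f_equal; ring.
    + rewrite T0; unfold expi, RtoC; rewrite cos_0, sin_0; reflexivity.
Qed.

(** * Stability and rigidity *)

Definition frame_distance (X T Y V : R -> C) (s : R) : R :=
  (Re (X s) - Re (Y s)) ^ 2 + (Im (X s) - Im (Y s)) ^ 2
  + ((Re (T s) - Re (V s)) ^ 2 + (Im (T s) - Im (V s)) ^ 2).

Lemma gronwall : forall (E dE : R -> R) K S, 0 <= K ->
  (forall s, is_derive E s (dE s)) -> (forall s, 0 <= E s) ->
  (forall s, Rabs s <= S -> Rabs (dE s) <= K * E s) ->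
  forall s, Rabs s <= S -> E s <= E 0 * exp (K * S).
Proof.
  intros E dE K S PK DE PE B s Hs.
  destruct (sign_decomposition s) as [e [He Es]].
  assert (D : forall v, is_derive (fun v => E (0 + e * v) * exp (- K * v)) v
    ((e * dE (0 + e * v) - K * E (0 + e * v)) * exp (- K * v))).
  { intros v.
    assert (Dexp : is_derive (fun v => exp (- K * v)) v (- K * exp (- K * v)))
      by (auto_derive; trivial; ring).
    apply (is_derive_eq _ _ _ _ (is_derive_product _ _ _ _ _
      (is_derive_affine E 0 e v _ (DE _)) Dexp)); ring. }
  assert (I := increment_le _ _ 0 (Rabs s) 0 (Rabs_pos s) (fun v _ => D v)).
  cbv beta in I; rewrite Rmult_0_r, Rmult_0_r, exp_0, !Rplus_0_l, <- Es in I.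
  assert (I' : E s * exp (- K * Rabs s) <= E 0).
  { cut (E s * exp (- K * Rabs s) - E 0 * 1 <= 0 * (Rabs s - 0)); [lra|]; apply I.
    intros v Hv; rewrite Rplus_0_l.
    assert (Bv := B (e * v)); rewrite (abs_sign_mult e v He (proj1 Hv)) in Bv.
    specialize (Bv ltac:(lra)); apply Rabs_le_between in Bv.
    rewrite <- (Rmult_0_l (exp (- K * v))).
    apply Rmult_le_compat_r; [left; apply exp_pos|].
    destruct He as [-> | ->]; lra. }
  apply Rle_trans with (E 0 * exp (K * Rabs s)).
  - apply (Rmult_le_reg_r (exp (- K * Rabs s))); [apply exp_pos|].
    rewrite Rmult_assoc, <- exp_plus.
    replace (K * Rabs s + - K * Rabs s) with 0 by ring; rewrite exp_0; lra.
  - apply Rmult_le_compat_l; [apply PE|].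
    apply exp_monotone, Rmult_le_compat_l; assumption.
Qed.

Lemma profile_coordinates_bound : forall h X T, profile_solution h X T ->
  forall s, Rabs (Re (X s)) <= Rabs (Re (X 0)) + Rabs s /\
            Rabs (Im (X s)) <= Rabs (Im (X 0)) + Rabs s.
Proof.
  intros h X T HX s.
  assert (B : forall f df : R -> R, (forall u, is_derive f u (df u)) ->
            (forall u, Rabs (df u) <= 1) -> Rabs (f s) <= Rabs (f 0) + Rabs s).
  { intros f df D L; replace (f s) with ((f s - f 0) + f 0) by ring.
    apply Rle_trans with (1 := Rabs_triang _ _).
    generalize (abs_increment_le f df D L s 0); rewrite Rminus_0_r; lra. }
  split.
  - apply (B (fun u => Re (X u)) (fun u => Re (T u)) (fc_ReX _ _ _ HX)).
    intros u; apply (unit_coordinates _ _ (fc_unit _ _ _ HX u)).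
  - apply (B (fun u => Im (X u)) (fun u => Im (T u)) (fc_ImX _ _ _ HX)).
    intros u; apply (unit_coordinates _ _ (fc_unit _ _ _ HX u)).
Qed.

Lemma frame_distance_rate : forall p q r w k1 k2 L,
  let d := Rabs p + Rabs q + Rabs r + Rabs w in
  0 <= L -> Rabs k1 <= L * d -> Rabs k2 <= L * d ->
  Rabs (2 * p * r + 2 * q * w + 2 * r * k1 + 2 * w * k2)
  <= (8 + 8 * L) * (p ^ 2 + q ^ 2 + (r ^ 2 + w ^ 2)).
Proof.
  intros p q r w k1 k2 L d PL H1 H2.
  assert (E : p ^ 2 + q ^ 2 + (r ^ 2 + w ^ 2)
              = Rabs p ^ 2 + Rabs q ^ 2 + (Rabs r ^ 2 + Rabs w ^ 2))
    by (rewrite !pow2_abs; reflexivity).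
  assert (Pp := Rabs_pos p); assert (Pq := Rabs_pos q).
  assert (Pr := Rabs_pos r); assert (Pw := Rabs_pos w).
  assert (T : Rabs (2 * p * r + 2 * q * w + 2 * r * k1 + 2 * w * k2)
    <= 2 * (Rabs p * Rabs r) + 2 * (Rabs q * Rabs w)
       + 2 * (Rabs r * Rabs k1) + 2 * (Rabs w * Rabs k2)).
  { rewrite <- !Rabs_mult.
    generalize (Rle_abs (p * r)) (Rle_abs (q * w)) (Rle_abs (r * k1)) (Rle_abs (w * k2)).
    generalize (Rle_abs (- (p * r))) (Rle_abs (- (q * w)))
      (Rle_abs (- (r * k1))) (Rle_abs (- (w * k2))); rewrite !Rabs_Ropp.
    intros; apply Rabs_le; lra. }
  apply Rle_trans with (1 := T); rewrite E; clear T E.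
  assert (Q1 : Rabs r * Rabs k1 <= Rabs r * (L * d)) by (apply Rmult_le_compat_l; lra).
  assert (Q2 : Rabs w * Rabs k2 <= Rabs w * (L * d)) by (apply Rmult_le_compat_l; lra).
  assert (Dd : (Rabs r + Rabs w) * d
               <= 4 * (Rabs p ^ 2 + Rabs q ^ 2 + (Rabs r ^ 2 + Rabs w ^ 2))).
  { unfold d; clear Q1 Q2 H1 H2; revert Pp Pq Pr Pw.
    generalize (Rabs p) (Rabs q) (Rabs r) (Rabs w); intros x y z t Px Py Pz Pt.
    generalize (pow2_ge_0 (x - y)) (pow2_ge_0 (x - z)) (pow2_ge_0 (x - t))
      (pow2_ge_0 (y - z)) (pow2_ge_0 (y - t)) (pow2_ge_0 (z - t)).
    assert (0 <= (x + y) * (x + y + z + t)) by (apply Rmult_le_pos; lra).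
    intros; lra. }
  apply (Rmult_le_compat_l L) in Dd; [|exact PL].
  generalize (pow2_ge_0 (Rabs p - Rabs r)) (pow2_ge_0 (Rabs q - Rabs w))
    (pow2_ge_0 (Rabs p)) (pow2_ge_0 (Rabs q)) (pow2_ge_0 (Rabs r)) (pow2_ge_0 (Rabs w)).
  intros; lra.
Qed.

Lemma is_derive_sqr_minus : forall (f g : R -> R) s f' g',
  is_derive f s f' -> is_derive g s g' ->
  is_derive (fun u => (f u - g u) ^ 2) s (2 * (f s - g s) * (f' - g')).
Proof.
  intros f g s f' g' Hf Hg.
  assert (H : is_derive (fun u => f u - g u) s (f' - g'))
    by exact (is_derive_minus (V := R_NormedModule) f g s f' g' Hf Hg).
  apply (is_derive_ext (fun u => (f u - g u) * (f u - g u)));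
    [intros u; simpl; real_ring|].
  apply (is_derive_eq _ _ _ _ (is_derive_product _ _ _ _ _ H H)); ring.
Qed.

Lemma frame_distance_nonneg : forall X T Y V s, 0 <= frame_distance X T Y V s.
Proof.
  intros; unfold frame_distance.
  repeat apply Rplus_le_le_0_compat; apply pow2_ge_0.
Qed.

(** Unit speed bounds the positions for [|s| <= S] in terms of those at 0, so one
    Lipschitz constant serves all the curves at hand. *)
Lemma profile_stability : forall h B S, 0 < h -> 0 <= B -> 0 <= S ->
  exists K, 0 <= K /\ forall X T Y V,
    profile_solution h X T -> profile_solution h Y V ->
    Rabs (Re (X 0)) <= B -> Rabs (Im (X 0)) <= B ->
    Rabs (Re (Y 0)) <= B -> Rabs (Im (Y 0)) <= B ->
    forall s, Rabs s <= S ->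
      frame_distance X T Y V s <= K * frame_distance X T Y V 0.
Proof.
  intros h B S Hh PB PS.
  set (M := B + S + 1).
  destruct (frame_bend_lipschitz h M Hh) as [L [PL HL]]; [unfold M; lra|].
  assert (PM : 0 <= M) by (unfold M; lra).
  assert (PLM : 0 <= 2 * (L * M)).
  { apply Rmult_le_pos; [lra|]; apply Rmult_le_pos; lra. }
  exists (exp ((8 + 8 * (2 * (L * M))) * S)); split; [left; apply exp_pos|].
  intros X T Y V HX HY B1 B2 B3 B4 s Hs; rewrite Rmult_comm.
  set (k := fun s => frame_bend h (Re (X s)) (Im (X s)) (Re (T s)) (Im (T s))).
  set (l := fun s => frame_bend h (Re (Y s)) (Im (Y s)) (Re (V s)) (Im (V s))).
  apply (gronwall (frame_distance X T Y V)
    (fun s => 2 * (Re (X s) - Re (Y s)) * (Re (T s) - Re (V s))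
              + 2 * (Im (X s) - Im (Y s)) * (Im (T s) - Im (V s))
              + (2 * (Re (T s) - Re (V s)) * (- k s * Im (T s) - - l s * Im (V s))
                 + 2 * (Im (T s) - Im (V s)) * (k s * Re (T s) - l s * Re (V s)))));
    [lra | | intros; apply frame_distance_nonneg | | exact Hs].
  - intros u; unfold k, l; rewrite <- !along_across_frame_bend.
    unfold frame_distance.
    apply (is_derive_plus (V := R_NormedModule)
      (fun u => (Re (X u) - Re (Y u)) ^ 2 + (Im (X u) - Im (Y u)) ^ 2)
      (fun u => (Re (T u) - Re (V u)) ^ 2 + (Im (T u) - Im (V u)) ^ 2)).
    + apply (is_derive_plus (V := R_NormedModule)
        (fun u => (Re (X u) - Re (Y u)) ^ 2) (fun u => (Im (X u) - Im (Y u)) ^ 2)).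
      * exact (is_derive_sqr_minus _ _ _ _ _ (fc_ReX _ _ _ HX u) (fc_ReX _ _ _ HY u)).
      * exact (is_derive_sqr_minus _ _ _ _ _ (fc_ImX _ _ _ HX u) (fc_ImX _ _ _ HY u)).
    + apply (is_derive_plus (V := R_NormedModule)
        (fun u => (Re (T u) - Re (V u)) ^ 2) (fun u => (Im (T u) - Im (V u)) ^ 2)).
      * exact (is_derive_sqr_minus _ _ _ _ _ (fc_ReT _ _ _ HX u) (fc_ReT _ _ _ HY u)).
      * exact (is_derive_sqr_minus _ _ _ _ _ (fc_ImT _ _ _ HX u) (fc_ImT _ _ _ HY u)).
  - intros u Hu.
    set (d := Rabs (Re (X u) - Re (Y u)) + Rabs (Im (X u) - Im (Y u))
              + Rabs (Re (T u) - Re (V u)) + Rabs (Im (T u) - Im (V u))).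
    assert (D1 := Rabs_pos (Re (X u) - Re (Y u))).
    assert (D2 := Rabs_pos (Im (X u) - Im (Y u))).
    assert (D3 := Rabs_pos (Re (T u) - Re (V u))).
    assert (D4 := Rabs_pos (Im (T u) - Im (V u))).
    assert (Pd : 0 <= d) by (unfold d; lra).
    assert (Cl : forall x y, Rabs x <= M -> Rabs y <= M -> Rabs (x - y) <= d ->
               lipschitz_pair d M x y).
    { intros x y A1 A2 A3; repeat split; try assumption.
      assert (0 <= (B + S) * d) by (apply Rmult_le_pos; lra).
      unfold M; lra. }
    destruct (profile_coordinates_bound h X T HX u) as [X1 X2].
    destruct (profile_coordinates_bound h Y V HY u) as [Y1 Y2].
    destruct (unit_coordinates _ _ (fc_unit _ _ _ HX u)) as [T1 T2].
    destruct (unit_coordinates _ _ (fc_unit _ _ _ HY u)) as [V1 V2].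
    assert (C1 : lipschitz_pair d M (Re (X u)) (Re (Y u))) by (apply Cl; unfold M, d; lra).
    assert (C2 : lipschitz_pair d M (Im (X u)) (Im (Y u))) by (apply Cl; unfold M, d; lra).
    assert (C3 : lipschitz_pair d M (Re (T u)) (Re (V u))) by (apply Cl; unfold M, d; lra).
    assert (C4 : lipschitz_pair d M (Im (T u)) (Im (V u))) by (apply Cl; unfold M, d; lra).
    assert (Ck : lipschitz_pair d L (k u) (l u)) by (apply HL; assumption).
    destruct (lipschitz_pair_mult d L M _ _ _ _ Pd Ck C4) as [_ [_ R1]].
    destruct (lipschitz_pair_mult d L M _ _ _ _ Pd Ck C3) as [_ [_ R2]].
    unfold frame_distance.
    generalize (frame_distance_rate
      (Re (X u) - Re (Y u)) (Im (X u) - Im (Y u))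
      (Re (T u) - Re (V u)) (Im (T u) - Im (V u))
      (- k u * Im (T u) - - l u * Im (V u)) (k u * Re (T u) - l u * Re (V u))
      (2 * (L * M)) PLM); cbv zeta; intros I.
    rewrite <- Rplus_assoc; apply I; [|exact R2].
    replace (- k u * Im (T u) - - l u * Im (V u))
      with (- (k u * Im (T u) - l u * Im (V u))) by ring.
    rewrite Rabs_Ropp; exact R1.
Qed.

Lemma frame_distance_zero : forall X T Y V s,
  frame_distance X T Y V s <= 0 <-> X s = Y s /\ T s = V s.
Proof.
  intros X T Y V s; unfold frame_distance; split.
  - intros H.
    generalize (pow2_ge_0 (Re (X s) - Re (Y s))) (pow2_ge_0 (Im (X s) - Im (Y s)))
      (pow2_ge_0 (Re (T s) - Re (V s))) (pow2_ge_0 (Im (T s) - Im (V s))).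
    intros P1 P2 P3 P4.
    assert (Z : forall x y, (x - y) ^ 2 <= 0 -> x = y).
    { intros x y L; apply Rminus_diag_uniq; nra. }
    rewrite (C_split (X s)), (C_split (Y s)), (C_split (T s)), (C_split (V s)).
    split; f_equal; apply Z; lra.
  - intros [-> ->]; rewrite !Rminus_diag; simpl; lra.
Qed.

Lemma profile_unique : forall h X T Y V, 0 < h ->
  profile_solution h X T -> profile_solution h Y V ->
  X 0 = Y 0 -> T 0 = V 0 -> forall s, X s = Y s /\ T s = V s.
Proof.
  intros h X T Y V Hh HX HY EX ET s; apply frame_distance_zero.
  set (B := Rabs (Re (X 0)) + Rabs (Im (X 0))).
  assert (P1 := Rabs_pos (Re (X 0))); assert (P2 := Rabs_pos (Im (X 0))).
  destruct (profile_stability h B (Rabs s) Hh) as [K [PK HK]];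
    [unfold B; lra | apply Rabs_pos|].
  apply Rle_trans with (K * frame_distance X T Y V 0).
  - apply HK; try assumption; try rewrite <- EX; unfold B; lra.
  - assert (Z : frame_distance X T Y V 0 <= 0)
      by (apply frame_distance_zero; split; assumption).
    apply Rle_trans with (K * 0); [apply Rmult_le_compat_l; assumption | lra].
Qed.

Lemma expi_plus : forall a b, expi (a + b) = (expi a * expi b)%C.
Proof.
  intros a b; unfold expi, Cmult; cbn [fst snd]; rewrite cos_plus, sin_plus.
  f_equal; ring.
Qed.

Lemma profile_rotate : forall h X T a, profile_solution h X T ->
  profile_solution h (fun s => expi a * X s)%C (fun s => expi a * T s)%C.
Proof.
  intros h X T a HX; assert (F := framed_rotate X T _ a HX).
  split; try apply F; intros s; rewrite along_rotate, across_rotate; apply F.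
Qed.

Lemma sign_tangent_one : forall c T u, sign_tangent 1 c T u = T (c + 1 * u).
Proof.
  intros c T u; unfold sign_tangent; rewrite !Rmult_1_l; symmetry; apply C_split.
Qed.

(** Tau and nu are the coordinates of [X] in its frame: where they agree, the
    rotation carrying one tangent to the other also matches the positions, and
    uniqueness extends this to the whole curves. *)
Lemma profile_rigidity : forall h X T Y V s1 s2, 0 < h ->
  profile_solution h X T -> profile_solution h Y V ->
  along X T s1 = along Y V s2 -> across X T s1 = across Y V s2 ->
  equal_up_to_rotation_and_shift X Y.
Proof.
  intros h X T Y V s1 s2 Hh HX HY Ea Ec.
  destruct (C_expi_of_unit _ (fc_unit _ _ _ HX s1)) as [a Ha].
  destruct (C_expi_of_unit _ (fc_unit _ _ _ HY s2)) as [b Hb].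
  exists (b - a), (s1 - s2); intros s.
  assert (R : (expi (b - a) * T s1)%C = V s2).
  { rewrite Ha, Hb, <- expi_plus; f_equal; ring. }
  assert (HX' := profile_rotate h _ _ (b - a)
    (profile_reparametrize h X T 1 s1 (or_introl eq_refl) HX)).
  assert (HY' := profile_reparametrize h Y V 1 s2 (or_introl eq_refl) HY).
  destruct (profile_unique h _ _ _ _ Hh HX' HY') with (s := s - s2) as [E _].
  - unfold reparametrize; rewrite Rmult_0_r, !Rplus_0_r.
    rewrite (moving_frame_expand X T s1 (fc_unit _ _ _ HX s1)).
    rewrite (moving_frame_expand Y V s2 (fc_unit _ _ _ HY s2)).
    rewrite Cmult_assoc, (Cmult_comm (expi _)), <- Cmult_assoc, R, Ea, Ec; reflexivity.
  - rewrite !sign_tangent_one, Rmult_0_r, !Rplus_0_r; exact R.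
  - unfold reparametrize in E.
    replace (s2 + 1 * (s - s2)) with s in E by ring.
    replace (s1 + 1 * (s - s2)) with (s + (s1 - s2)) in E by ring.
    symmetry; exact E.
Qed.

Lemma equal_up_to_invariants : forall h X T Y V,
  profile_solution h X T -> profile_solution h Y V ->
  equal_up_to_rotation_and_shift X Y ->
  exists c, forall s, along Y V s = along X T (s + c) /\
                      across Y V s = across X T (s + c).
Proof.
  intros h X T Y V HX HY [a [c E]]; exists c.
  set (Z := fun s => (expi a * reparametrize 1 c X s)%C).
  set (W := fun s => (expi a * sign_tangent 1 c T s)%C).
  assert (HZ : profile_solution h Z W).
  { apply profile_rotate, profile_reparametrize; [left; reflexivity | exact HX]. }
  assert (EZ : Y = Z).
  { apply functional_extensionality; intros s; rewrite E; unfold Z, reparametrize.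
    do 2 f_equal; ring. }
  intros s.
  assert (EV : V s = W s).
  { rewrite <- (framed_tangent Y V _ HY), <- (framed_tangent Z W _ HZ), EZ; reflexivity. }
  assert (EA : along Y V s = along Z W s)
    by (unfold along; rewrite EZ, EV; reflexivity).
  assert (EC : across Y V s = across Z W s)
    by (unfold across; rewrite EZ, EV; reflexivity).
  rewrite EA, EC; unfold Z, W; rewrite along_rotate, across_rotate.
  rewrite along_sign, across_sign, !Rmult_1_l, (Rplus_comm c); split; reflexivity.
Qed.

Lemma tau_zero_unique : forall h t n s1 s2, 0 < h ->
  solves_tau_nu_system h t n -> t s1 = 0 -> t s2 = 0 -> s1 = s2.
Proof.
  intros h t n s1 s2 Hh H Z1 Z2.
  destruct (Rtotal_order s1 s2) as [L | [L | L]]; [|exact L|].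
  - generalize (tau_positive_after_zero h t n s1 Hh H Z1 s2 L); lra.
  - generalize (tau_positive_after_zero h t n s2 Hh H Z2 s1 L); lra.
Qed.

(** * The one-parameter family *)

Lemma continuous_into_plane : forall (F : R * R -> C) q,
  continuous (fun q => Re (F q)) q -> continuous (fun q => Im (F q)) q ->
  continuous F q.
Proof.
  intros F q H1 H2; apply filterlim_locally; intros eps.
  generalize (proj1 (filterlim_locally _ _) H1 eps)
    (proj1 (filterlim_locally _ _) H2 eps); intros B1 B2.
  generalize (filter_and _ _ B1 B2); apply filter_imp.
  intros u [A1 A2]; split; assumption.
Qed.

(** The increment is split at [f p0 s]: continuity of [f p0] controls one part, the
    estimate in [p], uniform in [s], the other. *)
Lemma jointly_continuous : forall (f : R -> R -> R) p0 s0 K, 0 <= K ->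
  continuous (f p0) s0 ->
  (forall p s, Rabs (p - p0) <= 1 -> Rabs s <= Rabs s0 + 1 ->
     Rabs (f p s - f p0 s) <= K * Rabs (p - p0)) ->
  continuous (fun q : R * R => f (fst q) (snd q)) (p0, s0).
Proof.
  intros f p0 s0 K PK Cf L; apply filterlim_locally; intros eps.
  assert (Pe : 0 < eps / 2) by (generalize (cond_pos eps); lra).
  destruct (proj1 (filterlim_locally _ _) Cf (mkposreal _ Pe)) as [d Hd].
  assert (Pm : 0 < Rmin (Rmin d 1) (eps / 2 / (K + 1))).
  { repeat apply Rmin_glb_lt; [apply cond_pos | lra|].
    apply Rdiv_lt_0_compat; lra. }
  exists (mkposreal _ Pm); intros [p s] [Bp Bs]; simpl fst in *; simpl snd in *.
  change (Rabs (p - p0) < Rmin (Rmin d 1) (eps / 2 / (K + 1))) in Bp.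
  change (Rabs (s - s0) < Rmin (Rmin d 1) (eps / 2 / (K + 1))) in Bs.
  change (Rabs (f p s - f p0 s0) < eps).
  assert (M1 := Rmin_l (Rmin d 1) (eps / 2 / (K + 1))).
  assert (M2 := Rmin_r (Rmin d 1) (eps / 2 / (K + 1))).
  assert (M3 := Rmin_l d 1); assert (M4 := Rmin_r d 1).
  assert (N1 : Rabs (f p0 s - f p0 s0) < eps / 2).
  { apply (Hd s); change (Rabs (s - s0) < d); lra. }
  assert (N2 : Rabs (f p s - f p0 s) <= K * Rabs (p - p0)).
  { apply L; [lra|]; replace s with ((s - s0) + s0) by ring.
    apply Rle_trans with (1 := Rabs_triang _ _); lra. }
  assert (N3 : K * Rabs (p - p0) <= eps / 2).
  { apply Rle_trans with ((K + 1) * (eps / 2 / (K + 1))); [|right; field; lra].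
    apply Rmult_le_compat; [exact PK | apply Rabs_pos | lra | lra]. }
  replace (f p s - f p0 s0) with ((f p s - f p0 s) + (f p0 s - f p0 s0)) by ring.
  apply Rle_lt_trans with (1 := Rabs_triang _ _); lra.
Qed.

Lemma abs_le_of_sqr_le : forall x K d, 0 <= K -> 0 <= d ->
  x ^ 2 <= K * d ^ 2 -> Rabs x <= (K + 1) * d.
Proof.
  intros x K d PK Pd H; assert (P : 0 <= (K + 1) * d) by (apply Rmult_le_pos; lra).
  rewrite <- (Rabs_pos_eq _ P); apply Rsqr_le_abs_0; unfold Rsqr.
  assert (0 <= (K * K + K + 1) * d ^ 2) by (apply Rmult_le_pos; nra); nra.
Qed.

Lemma standard_curve_invariants : forall X T p,
  X 0 = (0, p) -> T 0 = RtoC 1 -> along X T 0 = 0 /\ across X T 0 = p.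
Proof.
  intros X T p EX ET; rewrite along_expand, across_expand, EX, ET.
  unfold RtoC, Re, Im; simpl; split; ring.
Qed.

Lemma standard_family_continuous : forall h (X T : R -> R -> C), 0 < h ->
  (forall p, profile_solution h (X p) (T p)) ->
  (forall p, X p 0 = (0, p)) -> (forall p, T p 0 = RtoC 1) ->
  forall q : R * R,
    continuous (fun q : R * R => X (fst q) (snd q)) q /\
    continuous (fun q : R * R => T (fst q) (snd q)) q.
Proof.
  intros h X T Hh HX X0 T0 [p0 s0].
  destruct (profile_stability h (Rabs p0 + 1) (Rabs s0 + 1) Hh) as [K [PK HK]];
    [generalize (Rabs_pos p0); lra | generalize (Rabs_pos s0); lra|].
  assert (D : forall p s, Rabs (p - p0) <= 1 -> Rabs s <= Rabs s0 + 1 ->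
    frame_distance (X p) (T p) (X p0) (T p0) s <= K * Rabs (p - p0) ^ 2).
  { intros p s Hp Hs.
    assert (E0 : frame_distance (X p) (T p) (X p0) (T p0) 0 = Rabs (p - p0) ^ 2).
    { unfold frame_distance; rewrite !X0, !T0, pow2_abs; unfold Re, Im; simpl; ring. }
    rewrite <- E0; apply HK; try apply HX; try exact Hs;
      rewrite X0; unfold Re, Im; simpl; try (rewrite Rabs_R0);
      try (generalize (Rabs_pos p0); lra).
    replace p with ((p - p0) + p0) by ring.
    apply Rle_trans with (1 := Rabs_triang _ _); lra. }
  assert (C : forall f : R -> R -> R,
    (forall s, ex_derive (f p0) s) ->
    (forall p s, (f p s - f p0 s) ^ 2
                 <= frame_distance (X p) (T p) (X p0) (T p0) s) ->
    continuous (fun q : R * R => f (fst q) (snd q)) (p0, s0)).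
  { intros f Df Bf; apply (jointly_continuous f p0 s0 (K + 1)); [lra| |].
    - apply (ex_derive_continuous (V := R_NormedModule)), Df.
    - intros p s Hp Hs; apply abs_le_of_sqr_le; [exact PK | apply Rabs_pos|].
      apply Rle_trans with (1 := Bf p s), D; assumption. }
  assert (Q := pow2_ge_0).
  split; apply continuous_into_plane.
  - apply (C (fun p s => Re (X p s))).
    + intros s; eexists; apply (fc_ReX _ _ _ (HX p0)).
    + intros p s; unfold frame_distance.
      generalize (Q (Im (X p s) - Im (X p0 s))) (Q (Re (T p s) - Re (T p0 s)))
        (Q (Im (T p s) - Im (T p0 s))); lra.
  - apply (C (fun p s => Im (X p s))).
    + intros s; eexists; apply (fc_ImX _ _ _ (HX p0)).
    + intros p s; unfold frame_distance.
      generalize (Q (Re (X p s) - Re (X p0 s))) (Q (Re (T p s) - Re (T p0 s)))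
        (Q (Im (T p s) - Im (T p0 s))); lra.
  - apply (C (fun p s => Re (T p s))).
    + intros s; eexists; apply (fc_ReT _ _ _ (HX p0)).
    + intros p s; unfold frame_distance.
      generalize (Q (Re (X p s) - Re (X p0 s))) (Q (Im (X p s) - Im (X p0 s)))
        (Q (Im (T p s) - Im (T p0 s))); lra.
  - apply (C (fun p s => Im (T p s))).
    + intros s; eexists; apply (fc_ImT _ _ _ (HX p0)).
    + intros p s; unfold frame_distance.
      generalize (Q (Re (X p s) - Re (X p0 s))) (Q (Im (X p s) - Im (X p0 s)))
        (Q (Re (T p s) - Re (T p0 s))); lra.
Qed.

(** Tau vanishes at exactly one point of [Y], and at the point 0 of [X p], where
    nu is [p]; so [p] has to be the value of nu at the zero of tau. *)
Lemma standard_family_classifies : forall h (X T : R -> R -> C) Y V, 0 < h ->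
  (forall p, profile_solution h (X p) (T p)) ->
  (forall p, X p 0 = (0, p)) -> (forall p, T p 0 = RtoC 1) ->
  profile_solution h Y V ->
  exists! p, equal_up_to_rotation_and_shift (X p) Y.
Proof.
  intros h X T Y V Hh HX X0 T0 HY.
  assert (HS := profile_system h Y V Hh HY).
  destruct (tau_vanishes h _ _ Hh HS) as [s0 Z].
  exists (across Y V s0); split.
  - destruct (standard_curve_invariants _ _ _ (X0 (across Y V s0)) (T0 (across Y V s0)))
      as [E1 E2].
    apply (profile_rigidity h _ (T (across Y V s0)) Y V 0 s0 Hh); [apply HX | exact HY | |].
    + rewrite E1, Z; reflexivity.
    + exact E2.
  - intros p E.
    destruct (equal_up_to_invariants h _ _ Y V (HX p) HY E) as [c Hc].
    destruct (Hc s0) as [E1 E2].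
    destruct (standard_curve_invariants _ _ _ (X0 p) (T0 p)) as [F1 F2].
    replace (s0 + c) with 0 in E2; [rewrite E2; exact F2|].
    apply (tau_zero_unique h _ _ _ _ Hh (profile_system h _ _ Hh (HX p)));
      [exact F1 | rewrite <- E1; exact Z].
Qed.

Lemma profile_trajectory : forall h X T q, profile_solution h X T ->
  trajectory X q <-> exists s, q = (along X T s, across X T s).
Proof.
  intros h X T q HX; unfold trajectory; split; intros [s E]; exists s; revert E;
    rewrite (framed_tau X T _ HX), (framed_nu X T _ HX); trivial.
Qed.

Lemma standard_family : forall h, 0 < h -> exists X, one_parameter_family h X.
Proof.
  intros h Hh.
  destruct (functional_choice (fun (p : R) (F : (R -> C) * (R -> C)) =>
    profile_solution h (fst F) (snd F) /\ fst F 0 = (0, p) /\ snd F 0 = RtoC 1))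
    as [F HF].
  { intros p; destruct (profile_exists h (0, p) Hh) as [X [T H]].
    exists (X, T); exact H. }
  set (X := fun p => fst (F p)); set (T := fun p => snd (F p)).
  assert (HX : forall p, profile_solution h (X p) (T p)) by (intros p; apply HF).
  assert (X0 : forall p, X p 0 = (0, p)) by (intros p; apply HF).
  assert (T0 : forall p, T p 0 = RtoC 1) by (intros p; apply HF).
  clearbody X T; clear F HF.
  assert (Class := fun Y V => standard_family_classifies h X T Y V Hh HX X0 T0).
  assert (Refl : forall Y, equal_up_to_rotation_and_shift Y Y).
  { intros Y; exists 0, 0; intros s; rewrite Rplus_0_r.
    replace (expi 0) with (RtoC 1)
      by (unfold expi, RtoC; rewrite cos_0, sin_0; reflexivity).
    rewrite Cmult_1_l; reflexivity. }
  assert (Meet : forall Y V Z W q, profile_solution h Y V -> profile_solution h Z W ->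
            trajectory Y q -> trajectory Z q -> equal_up_to_rotation_and_shift Y Z).
  { intros Y V Z W q HY HZ TY TZ.
    apply (profile_trajectory h Y V q HY) in TY; destruct TY as [s1 E1].
    apply (profile_trajectory h Z W q HZ) in TZ; destruct TZ as [s2 E2].
    rewrite E1 in E2; injection E2 as Ea Ec.
    exact (profile_rigidity h Y V Z W s1 s2 Hh HY HZ Ea Ec). }
  exists X; split; [|split; [|split; [|split; [|split]]]].
  - intros p; exact (profile_generates h _ _ Hh (HX p)).
  - intros q; destruct (standard_family_continuous h X T Hh HX X0 T0 q) as [C1 C2].
    split; [exact C1|].
    apply (continuous_ext (fun q : R * R => T (fst q) (snd q))); [|exact C2].
    intros [p s]; symmetry; exact (framed_tangent _ _ _ (HX p) s).
  - intros Y HY; exact (Class Y (tangent Y) (generator_profile h Y Hh HY)).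
  - intros p.
    replace (tau (X p)) with (along (X p) (T p))
      by (apply functional_extensionality; intros s; symmetry;
          apply (framed_tau _ _ _ (HX p))).
    replace (nu (X p)) with (across (X p) (T p))
      by (apply functional_extensionality; intros s; symmetry;
          apply (framed_nu _ _ _ (HX p))).
    exact (profile_system h _ _ Hh (HX p)).
  - intros q.
    destruct (profile_exists h q Hh) as [Y [V [HY [Y0 V0]]]].
    destruct (Class Y V HY) as [p [Ep _]].
    destruct (equal_up_to_invariants h _ _ Y V (HX p) HY Ep) as [c Hc].
    assert (Tp : trajectory (X p) q).
    { apply (profile_trajectory h _ _ q (HX p)); exists (0 + c).
      rewrite <- (proj1 (Hc 0)), <- (proj2 (Hc 0)).
      rewrite along_expand, across_expand, Y0, V0.
      destruct q as [a b]; unfold RtoC, Re, Im; simpl; f_equal; ring. }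
    exists p; split; [exact Tp|]; intros p' Tp'.
    destruct (Class (X p') (T p') (HX p')) as [p'' [_ U]].
    transitivity p''; [symmetry|]; apply U; [|apply Refl].
    exact (Meet _ _ _ _ q (HX p) (HX p') Tp Tp').
  - intros Y Z HY HZ E.
    assert (Tq : trajectory Y (tau Y 0, nu Y 0)) by (exists 0; reflexivity).
    exact (Meet Y _ Z _ _ (generator_profile h Y Hh HY) (generator_profile h Z Hh HZ)
             Tq (proj1 (E _) Tq)).
Qed.

Theorem theorem4p1 : forall h : R, 0 < h ->
  (exists X : R -> R -> C, one_parameter_family h X) /\
  (forall X : R -> C, generates_rotator h X ->
     exists s0 : R,
       unique (closest_to_origin X) s0 /\
       arm_properties X s0 1 /\
       arm_properties X s0 (- 1)).
Proof.
  intros h Hh; split; [exact (standard_family h Hh)|].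
  intros X HX; exact (profile_arms h X _ Hh (generator_profile h X Hh HX)).
Qed.
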